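(* Let $n\in\mathbb{N}$ and $0<\gamma<n$, and suppose that $A$ and $B$ are Young functions. The following assertions are equivalent: (i) There exists a constant $C_1>0$ such that $$\|M_\gamma f\|_{L^B(\mathbb{R}^n)}\le C_1\|f\|_{L^A(\mathbb{R}^n)}\quad\text{for every } f\in L^A(\mathbb{R}^n).$$ (ii) There exists a constant $C_2>0$ such that $$\int_{\mathbb{R}^n} B\left(\frac{M_\gamma f(x)}{C_2\left(\int_{\mathbb{R}^n}A(|f(y)|)\,dy\right)^{\gamma/n}}\right)dx\le\int_{\mathbb{R}^n}A(|f(x)|)\,dx\quad\text{for every } f\in L^A(\mathbb{R}^n).$$ (iii) $\inf_{0<t<1}A(t)\,t^{-n/\gamma}>0$, and there exists a constant $C_3>0$ such that $$\int_0^t\frac{B(s)}{s^{n/(n-\gamma)+1}}\,ds\le\frac{A_{n/\gamma}(C_3t)}{t^{n/(n-\gamma)}}\quad\text{for every } t>0.$$ (iv) $\int_0\frac{B(s)}{s^{n/(n-\gamma)+1}}\,ds<\infty$ (convergence near zero), and there exists a constant $C_4>0$ such that $$B_{n/\gamma}(t)\le A(C_4t)\quad\text{for every } t>0.$$ Moreover, the constants $C_1,C_2,C_3,C_4$ depend only on each other and on $n$ and $\gamma$ (that is, if one of the assertions holds with constant $C_i$, then each other assertion holds with a constant $C_j$ depending only on $C_i$, $n$ and $\gamma$).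
   Context: A Young function is a convex, left-continuous function $A:[0,\infty)\to[0,\infty]$ with $A(0)=0$ which is not constant on $(0,\infty)$ (i.e. neither identically $0$ nor identically $\infty$ there). Put $A(\infty)=\infty$. For a nondecreasing $\Phi:[0,\infty)\to[0,\infty]$, $\Phi^{-1}(s)=\inf\{t\ge0:\Phi(t)>s\}$ (with $\inf\emptyset=\infty$) denotes its generalized right-continuous inverse. The Orlicz space $L^A(\mathbb{R}^n)$ consists of the measurable functions $f$ on $\mathbb{R}^n$ with $\int_{\mathbb{R}^n}A(|f(x)|/\lambda)\,dx<\infty$ for some $\lambda>0$, with the Luxemburg norm $\|f\|_{L^A(\mathbb{R}^n)}=\inf\{\lambda>0:\int_{\mathbb{R}^n}A(|f(x)|/\lambda)\,dx\le1\}$. The fractional maximal operator is $M_\gamma f(x)=\sup_{Q\ni x}|Q|^{\gamma/n-1}\int_Q|f(y)|\,dy$, $x\in\mathbb{R}^n$, for locally integrable $f$, the supremum being over all cubes $Q$ containing $x$ with sides parallel to the coordinate axes. Construction of $A_{n/\gamma}$: if $\inf_{0<t<1}A(t)t^{-n/\gamma}>0$, set $G_{n/\gamma}(t)=\sup_{0<s\le t}A^{-1}(s)\,s^{-\gamma/n}$ for $t\ge0$ (with value $0$ at $t=0$), and $A_{n/\gamma}(t)=\int_0^t\frac{G_{n/\gamma}^{-1}(s)}{s}\,ds$ for $t\ge0$. This is a Young function. Construction of $B_{n/\gamma}$: if $\int_0\frac{B(s)}{s^{n/(n-\gamma)+1}}ds<\infty$, i.e. the integral converges over some interval $(0,\delta)$,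 set $F_{n/\gamma}(t)=t^{n/(n-\gamma)}\int_0^t\frac{B(s)}{s^{n/(n-\gamma)+1}}ds\in[0,\infty]$ (value $0$ at $t=0$), $E_{n/\gamma}(t)=t^{\gamma/n}F_{n/\gamma}^{-1}(t)$, and $B_{n/\gamma}(t)=\int_0^t\frac{E_{n/\gamma}^{-1}(s)}{s}\,ds$ for $t\ge0$. This is a Young function. In (ii), the inequality is regarded as trivially true if $\int_{\mathbb{R}^n}A(|f|)=\infty$; when $\int_{\mathbb{R}^n}A(|f|)=0$ one uses $0/0=0$ and $c/0=\infty$ for $c>0$. *)

(* Defs.v *)
From HB Require Import structures.
From mathcomp Require Import all_boot all_order all_algebra.
From mathcomp Require Import all_classical all_reals all_analysis.
From mathcomp Require Import measurable_realfun.

Set Implicit Arguments.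
Unset Strict Implicit.
Unset Printing Implicit Defensive.
Import Order.TTheory GRing.Theory Num.Theory.
Import numFieldNormedType.Exports.

Local Open Scope classical_set_scope.
Local Open Scope ring_scope.
Local Open Scope ereal_scope.

Section LebesgueSpace.
Context {R : realType}.

Definition cons_pair (n : nat)
    (p : n.-tuple (measurableTypeR R) * measurableTypeR R) :
  n.+1.-tuple (measurableTypeR R) := [tuple of p.2 :: p.1].

Lemma measurable_cons_pair (n : nat) : measurable_fun setT (@cons_pair n).
Proof. exact: measurable_cons. Qed.

Section BorelLebesgueStep.
Variables (n : nat) (m : {measure set (n.-tuple (measurableTypeR R)) -> \bar R}).

Definition borel_lebesgueS : set (n.+1.-tuple (measurableTypeR R)) -> \bar R :=
  pushforward (m \x @lebesgue_measure R) (@cons_pair n).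

Let borel_lebesgueS0 : borel_lebesgueS set0 = 0.
Proof. by rewrite /borel_lebesgueS /pushforward preimage_set0 measure0. Qed.

Let borel_lebesgueS_ge0 X : 0 <= borel_lebesgueS X.
Proof. by rewrite /borel_lebesgueS /pushforward; exact: measure_ge0. Qed.

Let borel_lebesgueS_sigma_additive : semi_sigma_additive borel_lebesgueS.
Proof.
move=> F mF tF mUF; rewrite /borel_lebesgueS /pushforward preimage_bigcup.
have mcF X : measurable X -> measurable (@cons_pair n @^-1` X).
  by move=> mX; rewrite -[X in measurable X]setTI; exact: measurable_cons_pair.
apply: measure_semi_sigma_additive.
- by move=> k; exact: mcF.
- apply/trivIsetP => /= i j _ _ ij; rewrite -preimage_setI.
  by move/trivIsetP : tF => /(_ _ _ _ _ ij) ->//; rewrite preimage_set0.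
- by rewrite -preimage_bigcup; exact: mcF.
Qed.

HB.instance Definition _ := isMeasure.Build _ _ _
  borel_lebesgueS borel_lebesgueS0 borel_lebesgueS_ge0
  borel_lebesgueS_sigma_additive.

End BorelLebesgueStep.

(* The n-fold product of the one-dimensional Lebesgue measure on the Borel
   sigma-algebra of R^n. *)
Fixpoint borel_lebesgue (n : nat) :
    {measure set (n.-tuple (measurableTypeR R)) -> \bar R} :=
  match n with
  | 0%N => \d_([tuple] : 0.-tuple (measurableTypeR R))
  | m.+1 => borel_lebesgueS (borel_lebesgue m)
  end.

(* R^n with the Lebesgue sigma-algebra, i.e. the Caratheodory-measurable sets
   of the outer measure generated by borel_lebesgue. *)
Definition euclidean (n : nat) := caratheodory_type (borel_lebesgue n)^*%mu.

Definition lebesgue (n : nat) : {measure set (euclidean n) -> \bar R} :=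
  @completed_measure_extension _ _ _ (borel_lebesgue n).

Definition eucl_coord (n : nat) (x : euclidean n) (i : 'I_n) : R :=
  tnth (x : n.-tuple R) i.

(* Nondegenerate closed cubes with sides parallel to the axes. *)
Definition is_cube (n : nat) (Q : set (euclidean n)) : Prop :=
  exists (a : 'I_n -> R) (l : R), (0 < l)%R /\
    Q = [set x | forall i, (a i <= eucl_coord x i <= a i + l)%R].

End LebesgueSpace.
Arguments euclidean : clear implicits.
Arguments lebesgue : clear implicits.

Section Young.
Context {R : realType}.

(* Young functions are total functions on R of which only the restriction to
   [0, +oo[ is ever used. *)
Record young_function (A : R -> \bar R) : Prop := YoungFunction {
  young_ge0 : forall t, (0 <= t)%R -> 0 <= A t ;
  young0 : A 0%R = 0 ;
  young_convex : forall s t p, (0 <= s)%R -> (0 <= t)%R -> (0 <= p <= 1)%R ->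
    A (p * s + (1 - p) * t)%R <= p%:E * A s + (1 - p)%:E * A t ;
  young_left_continuous : forall t, (0 < t)%R -> A s @[s --> t^'-] --> A t ;
  young_nonconstant : ~ exists c, forall t, (0 < t)%R -> A t = c }.

(* A(oo) = oo *)
Definition young_ext (A : R -> \bar R) (t : \bar R) : \bar R :=
  if t is r%:E then A r else +oo.

(* inf {t >= 0 : Phi(t) > s}, with inf of the empty set equal to +oo *)
Definition right_inverse (Phi : R -> \bar R) (s : R) : \bar R :=
  ereal_inf [set t%:E | t in [set t | (0 <= t)%R /\ s%:E < Phi t]].

Variables (n : nat) (gamma : R).

Definition in_orlicz (A : R -> \bar R) (f : euclidean R n -> \bar R) : Prop :=
  measurable_fun setT f /\
  exists2 lam : R, (0 < lam)%R &
    \int[lebesgue R n]_x young_ext A (`|f x| / lam%:E) < +oo.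

Definition luxemburg (A : R -> \bar R) (f : euclidean R n -> \bar R) : \bar R :=
  ereal_inf [set lam%:E | lam in [set lam : R | (0 < lam)%R /\
    \int[lebesgue R n]_x young_ext A (`|f x| / lam%:E) <= 1]].

Definition frac_maximal (f : euclidean R n -> \bar R) (x : euclidean R n) :
    \bar R :=
  ereal_sup [set lebesgue R n Q `^ (gamma / n%:R - 1)%R *
                 \int[lebesgue R n]_(y in Q) `|f y|
            | Q in [set Q | is_cube Q /\ Q x]].

Definition integral0 (t : R) (h : R -> \bar R) : \bar R :=
  \int[@lebesgue_measure R]_(s in `]0%R, t[) h s.

Definition A_cond (A : R -> \bar R) : Prop :=
  0 < ereal_inf [set A t * (t `^ (- (n%:R / gamma)))%:E | t in `]0%R, 1%R[].

Definition G_fun (A : R -> \bar R) (t : R) : \bar R :=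
  if t == 0%R then 0 else
  ereal_sup [set right_inverse A s * (s `^ (- (gamma / n%:R)))%:E
            | s in `]0%R, t]].

(* The Young function A_{n/gamma}; meaningful when A_cond A holds. *)
Definition A_young (A : R -> \bar R) (t : R) : \bar R :=
  integral0 t (fun s => right_inverse (G_fun A) s / s%:E).

Definition target_exp : R := (n%:R / (n%:R - gamma))%R.

Definition B_integral (B : R -> \bar R) (t : R) : \bar R :=
  integral0 t (fun s => B s / (s `^ (target_exp + 1))%:E).

Definition B_cond (B : R -> \bar R) : Prop :=
  exists2 delta : R, (0 < delta)%R & B_integral B delta < +oo.

Definition F_fun (B : R -> \bar R) (t : R) : \bar R :=
  (t `^ target_exp)%:E * B_integral B t.

Definition E_fun (B : R -> \bar R) (t : R) : \bar R :=
  (t `^ (gamma / n%:R))%:E * right_inverse (F_fun B) t.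

(* The Young function B_{n/gamma}; meaningful when B_cond B holds. *)
Definition B_young (B : R -> \bar R) (t : R) : \bar R :=
  integral0 t (fun s => right_inverse (E_fun B) s / s%:E).

Definition norm_ineq (A B : R -> \bar R) (C : R) : Prop :=
  forall f : euclidean R n -> \bar R, in_orlicz A f ->
    luxemburg B (frac_maximal f) <= C%:E * luxemburg A f.

(* In \bar R, x / 0 is x * +oo with 0 * +oo = 0, hence 0 / 0 = 0 and
   c / 0 = +oo for c > 0; when the integral of A(|f|) is +oo the right-hand
   side is +oo and the inequality is trivially true. *)
Definition modular_ineq (A B : R -> \bar R) (C : R) : Prop :=
  forall f : euclidean R n -> \bar R, in_orlicz A f ->
    let IA := \int[lebesgue R n]_y young_ext A `|f y| in
    \int[lebesgue R n]_x
      young_ext B (frac_maximal f x / (C%:E * IA `^ (gamma / n%:R))) <= IA.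

Definition domain_ineq (A B : R -> \bar R) (C : R) : Prop :=
  A_cond A /\
  forall t, (0 < t)%R ->
    B_integral B t <= A_young A (C * t)%R / (t `^ target_exp)%:E.

Definition range_ineq (A B : R -> \bar R) (C : R) : Prop :=
  B_cond B /\ forall t, (0 < t)%R -> B_young B t <= A (C * t)%R.

Definition assertion (k : 'I_4) : (R -> \bar R) -> (R -> \bar R) -> R -> Prop :=
  match val k with
  | 0 => norm_ineq
  | 1 => modular_ineq
  | 2 => domain_ineq
  | _ => range_ineq
  end.

End Young.

(* Main.v *)
(* Write al = gamma / n, q = 1 / (1 - al) and
   F(t) = t^q \int_0^t B(s) / s^(q+1) ds. Up to the constants, each of the four
   assertions is equivalent to
     F(a tau^(-al) / C) <= tau  whenever  A(a) <= tau                  (core)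
   and constants are absorbed by F(e t) <= e^q F(t) for e <= 1, with q > 1.

   (iii), (iv) <-> core: the suprema and generalized inverses defining A_{n/gamma}
   and B_{n/gamma} unfold to pointwise inequalities, and h(t) is comparable to
   \int_0^t h(s) / s ds for h increasing with h(s) / s under control.

   (i) -> core: test on f = a 1_Q with |Q| = 1 / tau. On the dilated cube Q_k of
   measure 2^(kq) |Q| one has M f >= a tau^(-al) 2^(-k), and summing over k
   reproduces the integral in F dyadically.

   core -> (ii): let I = \int A(|f|). If a cube Q satisfies
   |Q|^(al-1) \int_Q |f| > 2 C p I^al, then convexity of A and core give
   |Q| <= I / F(p), so the average of |f| on Q exceeds 2 eta with
   eta = C p F(p)^al; hence eta |Q| <= \int_Q |f| 1_{|f| > eta}, and a Vitali
   covering bounds the level set of M f. For p = 2^j the resulting sum over j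
   telescopes in (\int_0^p B(s) / s^(q+1) ds)^(1-al), and core bounds it by A.

   (ii) -> (i) is homogeneity. *)
Require Import Defs.
From mathcomp Require Import all_boot all_order all_algebra.
From mathcomp Require Import all_classical all_reals all_analysis.
From mathcomp Require Import measurable_realfun.
From mathcomp Require Import ring lra zify.

Set Implicit Arguments.
Unset Strict Implicit.
Unset Printing Implicit Defensive.
Import Order.TTheory GRing.Theory Num.Theory.
Import numFieldNormedType.Exports.
Local Open Scope classical_set_scope.
Local Open Scope ring_scope.
Local Notation rinv := Defs.right_inverse.

(** * Integrals and series of nonnegative extended-real functions *)

Section NonnegativeIntegral.
Local Open Scope ereal_scope.
Context d (T : measurableType d) (R : realType).
Variable mu : {measure set T -> \bar R}.

(** The integral of a nonnegative function is a supremum over the simple functions below it, hence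
    monotone for arbitrary functions. This allows integrals of [B] of the maximal function to be
    compared without discussing the measurability of the latter. *)
Lemma le_integral_ge0 (D : set T) (f g : T -> \bar R) :
  (forall x, D x -> 0 <= f x) -> (forall x, D x -> f x <= g x) ->
  \int[mu]_(x in D) f x <= \int[mu]_(x in D) g x.
Proof.
move=> f0 fg; have g0 x : D x -> 0 <= g x by move=> Dx; rewrite (le_trans (f0 _ Dx)) ?fg.
rewrite !ge0_integralE//; apply: le_ereal_sup => _ [h hf <-]; exists h => // x.
apply: (le_trans (hf x)); rewrite /patch; case: ifPn => // /set_mem Dx; exact: fg.
Qed.

Lemma le_integral_set_ge0 (D E : set T) (f : T -> \bar R) :
  (forall x, E x -> 0 <= f x) -> D `<=` E ->
  \int[mu]_(x in D) f x <= \int[mu]_(x in E) f x.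
Proof.
move=> f0 DE; rewrite !(integral_mkcond _ f); apply: le_integral_ge0 => x _.
  by rewrite erestrict_ge0// => y /DE; exact: f0.
rewrite /patch; case: ifPn => [/set_mem/DE/mem_set ->//|_].
by case: ifPn => // /set_mem; exact: f0.
Qed.

Lemma integral_ge_cst (D S : set T) (f : T -> \bar R) (c : \bar R) :
  measurable S -> S `<=` D -> 0 <= c -> (forall x, D x -> 0 <= f x) ->
  (forall x, S x -> c <= f x) -> c * mu S <= \int[mu]_(x in D) f x.
Proof.
move=> mS SD c0 f0 cf; rewrite -integral_cst//.
by apply: le_trans (le_integral_set_ge0 f0 SD); apply: le_integral_ge0.
Qed.

Lemma integral_le_cst (D : set T) (f : T -> \bar R) (c : \bar R) :
  measurable D -> (forall x, D x -> 0 <= f x) -> (forall x, D x -> f x <= c) ->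
  \int[mu]_(x in D) f x <= c * mu D.
Proof. by move=> mD f0 fc; rewrite -integral_cst//; exact: le_integral_ge0. Qed.

Lemma integral_mul_indic (c : \bar R) (S : set T) : 0 <= c -> measurable S ->
  \int[mu]_x (c * (\1_S x)%:E) = c * mu S.
Proof.
move=> c0 mS; rewrite -integral_cst// [RHS]integral_mkcond; apply: eq_integral => x _.
by rewrite /patch indicE; case: (x \in S); rewrite ?mule1 ?mule0.
Qed.

(** Only the indicators on the right are integrated term by term. It serves twice: for the dyadic
    shells of the integral of [B], and for the level sets of the maximal function. *)
Lemma integral_le_series (D : set T) (S : nat -> set T) (c : nat -> \bar R)
    (g : T -> \bar R) :
  (forall k, measurable (S k)) -> (forall k, 0 <= c k) ->
  (forall x, D x -> 0 <= g x) ->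
  (forall x, D x -> g x <= \sum_(k <oo) c k * (\1_(S k) x)%:E) ->
  \int[mu]_(x in D) g x <= \sum_(k <oo) c k * mu (S k).
Proof.
move=> mS c0 g0 gS.
have h0 x : 0 <= \sum_(k <oo) c k * (\1_(S k) x)%:E.
  by apply: nneseries_ge0 => k _ _; rewrite mule_ge0// lee_fin.
apply: (@le_trans _ _ (\int[mu]_x \sum_(k <oo) c k * (\1_(S k) x)%:E)).
  rewrite integral_mkcond; apply: le_integral_ge0 => x _.
    by rewrite erestrict_ge0.
  by rewrite /patch; case: ifPn => // /set_mem; exact: gS.
rewrite integral_nneseries//.
- by rewrite (eq_eseriesr (fun k _ => integral_mul_indic (c0 k) (mS k))).
- move=> k; apply: emeasurable_funM => //.
  by apply/measurable_EFinP; exact: measurable_indic.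
- by move=> k x _; rewrite mule_ge0// lee_fin.
Qed.

Lemma sum_mul_measure_le (S : nat -> set T) (c : nat -> \bar R) (g : T -> \bar R) N :
  (forall k, measurable (S k)) -> (forall k, 0 <= c k) ->
  (forall x, \sum_(k < N) c k * (\1_(S k) x)%:E <= g x) ->
  \sum_(k < N) c k * mu (S k) <= \int[mu]_x g x.
Proof.
move=> mS c0 gS.
under eq_bigr do rewrite -integral_mul_indic//.
rewrite -ge0_integral_sum//; last 2 first.
- move=> k; apply: emeasurable_funM => //.
  by apply/measurable_EFinP; exact: measurable_indic.
- by move=> k x _; rewrite mule_ge0// lee_fin.
apply: le_integral_ge0 => // x _; apply: sume_ge0 => k _.
by rewrite mule_ge0// lee_fin.
Qed.

Lemma nneseries_le (u : nat -> \bar R) (M : \bar R) : (forall k, 0 <= u k) ->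
  (forall N, \sum_(k < N) u k <= M) -> \sum_(k <oo) u k <= M.
Proof.
move=> u0 uM; apply: lime_le; first exact: is_cvg_nneseries.
by near=> N; rewrite big_mkord.
Unshelve. all: by end_near. Qed.

Lemma nneseries_ge_term (u : nat -> \bar R) k : (forall k, 0 <= u k) ->
  u k <= \sum_(i <oo) u i.
Proof.
move=> u0; have := @nneseries_lim_ge R u xpredT 0%N k.+1.
move=> /(_ (fun n _ _ => u0 n)); apply: le_trans.
by rewrite big_nat_recr//= leeDr// sume_ge0.
Qed.

End NonnegativeIntegral.

(** * Measure of cubes in Euclidean space *)

Section EuclideanCubes.
Local Open Scope ereal_scope.
Context {R : realType}.

Lemma borel_box_measurable n (a b : 'I_n -> R) :
  measurable [set x : n.-tuple (measurableTypeR R) |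
    forall i, (a i <= tnth x i <= b i)%R].
Proof.
rewrite (_ : mkset _ = \big[setI/setT]_(i < n)
    ((fun x : n.-tuple (measurableTypeR R) => tnth x i) @^-1` `[a i, b i])); last first.
  apply/seteqP; split => x /=.
    by move=> xab; rewrite big_tnth; elim/big_ind: _ => // i _ /=; rewrite in_itv/=.
  move=> xab i; rewrite (bigD1 i)//= in xab.
  by case: xab => + _; rewrite in_itv.
apply: bigsetI_measurable => i _.
by rewrite -[X in measurable X]setTI; exact: measurable_tnth.
Qed.

Lemma borel_lebesgue_box n (a b : 'I_n -> R) : (forall i, a i <= b i)%R ->
  borel_lebesgue n [set x | forall i, (a i <= tnth x i <= b i)%R] =
  (\prod_(i < n) (b i - a i))%:E.
Proof.
elim: n a b => [|n IHn] a b ab.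
  by rewrite big_ord0 /= diracE mem_set// => -[].
rewrite big_ord_recl /= /borel_lebesgueS /pushforward.
pose a' i := a (lift ord0 i); pose b' i := b (lift ord0 i).
rewrite (_ : _ @^-1` _ = [set x : n.-tuple (measurableTypeR R) |
    forall i, (a' i <= tnth x i <= b' i)%R] `*` `[a ord0, b ord0]); last first.
  apply/seteqP; split => -[x y] /= H.
    split; last by move: (H ord0); rewrite in_itv/= /cons_pair tnth0.
    by move=> i; move: (H (lift ord0 i)); rewrite /cons_pair tnthS.
  case: H => xab yab i; case: (unliftP ord0 i) => [j|] ->.
    by rewrite /cons_pair tnthS; exact: xab.
  by rewrite /cons_pair tnth0; move: yab; rewrite in_itv.
rewrite [LHS]product_measure1E//; last exact: borel_box_measurable.
rewrite IHn => [|i]; last exact: ab.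
rewrite [X in _ * X]lebesgue_measure_itv/= lte_fin.
case: ltgtP (ab ord0) => // [_ _|-> _]; last by rewrite mule0 subrr mul0r.
by rewrite -EFinB -EFinM mulrC.
Qed.

Definition cube n (a : 'I_n -> R) (l : R) : set (euclidean R n) :=
  [set x | forall i, (a i <= eucl_coord x i <= a i + l)%R].

Lemma is_cube_cube n (a : 'I_n -> R) l : (0 < l)%R -> is_cube (cube a l).
Proof. by move=> l0; exists a, l. Qed.

Lemma measurable_cube n (a : 'I_n -> R) l : measurable (cube a l).
Proof.
apply: caratheodory_measurable_mu_ext.
exact: (@borel_box_measurable n a (fun i => a i + l)%R).
Qed.

Lemma lebesgue_cube n (a : 'I_n -> R) l : (0 <= l)%R ->
  lebesgue R n (cube a l) = (l ^+ n)%:E.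
Proof.
move=> l0; rewrite /lebesgue /= /completed_measure_extension.
rewrite measurable_mu_extE; last exact: (@borel_box_measurable n a (fun i => a i + l)%R).
rewrite [LHS](@borel_lebesgue_box n a (fun i => a i + l)%R); last by move=> i; rewrite lerDl.
by under eq_bigr do rewrite addrAC subrr add0r; rewrite prodr_const card_ord.
Qed.

End EuclideanCubes.

(** * Monotonicity and growth of Young functions *)

Section YoungFunctions.
Local Open Scope ereal_scope.
Context {R : realType} (A : R -> \bar R) (yA : young_function A).

Lemma young_contract (p t : R) : (0 <= t)%R -> (0 <= p <= 1)%R ->
  A (p * t)%R <= p%:E * A t.
Proof.
move=> t0 p01; have := young_convex yA t0 (lexx 0%R) p01.
by rewrite mulr0 addr0 young0// mule0 adde0.
Qed.

Lemma young_le (s t : R) : (0 <= s)%R -> (s <= t)%R -> A s <= A t.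
Proof.
move=> s0 st; have t0 : (0 <= t)%R by exact: le_trans st.
move: t0; rewrite le_eqVlt => /predU1P[t0|t0].
  by rewrite (_ : s = t)//; apply/eqP; rewrite eq_le st -t0 s0.
have p01 : (0 <= s / t <= 1)%R by rewrite divr_ge0 ?(ltW t0)//= ler_pdivrMr// mul1r.
have := young_contract (ltW t0) p01; rewrite divfK ?gt_eqF// => /le_trans; apply.
case/andP: p01 => p0 p1.
by rewrite -[leRHS]mul1e lee_pmul// ?lee_fin// (young_ge0 yA)// ltW.
Qed.

Lemma young_fin_ex : exists2 a : R, (0 < a)%R & A a < +oo.
Proof.
apply: contrapT => H; apply: (young_nonconstant yA); exists +oo => t t0.
by apply/eqP; rewrite -leye_eq leNgt; apply/negP => At; apply: H; exists t.
Qed.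

Lemma young_pos_ex : exists2 a : R, (0 < a)%R & 0 < A a.
Proof.
apply: contrapT => H; apply: (young_nonconstant yA); exists 0 => t t0.
apply/eqP; rewrite eq_le; apply/andP; split; last exact/(young_ge0 yA)/ltW.
by rewrite leNgt; apply/negP => At; apply: H; exists t.
Qed.

(** Contraction read backwards gives [A (K * a) >= K * A a] for [K >= 1], and [A a > 0] for some
    [a]. The real [r] stands in for [A a], which may be infinite. *)
Lemma young_unbounded (M : R) : exists2 t : R, (0 < t)%R & M%:E < A t.
Proof.
have [a a0 Aa] := young_pos_ex.
have [r [r0 rA]] : exists r : R, (0 < r)%R /\ r%:E <= A a.
  case: (A a) Aa => [r r0|_|//]; first by exists r.
  by exists 1%R; rewrite ltr01 leey.
pose K : R := Num.max 1%R ((`|M| + 1) / r)%R.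
have K1 : (1 <= K)%R by rewrite le_max lexx.
have K0 : (0 < K)%R by exact: lt_le_trans K1.
exists (K * a)%R; first exact: mulr_gt0.
have p01 : (0 <= K^-1 <= 1)%R by rewrite invr_ge0 ltW//= invf_le1.
have := @young_contract K^-1%R (K * a)%R (ltW (mulr_gt0 K0 a0)) p01.
rewrite mulKf ?gt_eqF// => /(le_trans rA); rewrite lee_pdivlMl// -EFinM => /(lt_le_trans _); apply.
rewrite lte_fin (@lt_le_trans _ _ (`|M| + 1)%R)//.
  by rewrite (le_lt_trans (ler_norm M))// ltrDl.
by rewrite -ler_pdivrMr// le_max lexx orbT.
Qed.

Lemma young_ext_le (s t : \bar R) : 0 <= s -> s <= t ->
  young_ext A s <= young_ext A t.
Proof.
case: s t => [s| |] [t| |]//=; rewrite ?lee_fin ?leey//.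
exact: young_le.
Qed.

Lemma young_ext_ge0 (s : \bar R) : 0 <= s -> 0 <= young_ext A s.
Proof. by case: s => [s| |]//=; rewrite lee_fin; exact: young_ge0. Qed.

End YoungFunctions.

(** * Generalized right-continuous inverses *)

Section RightInverse.
Local Open Scope ereal_scope.
Context {R : realType} (Phi : R -> \bar R).

Lemma right_inverse_ge0 s : 0 <= rinv Phi s.
Proof. by apply: le_ereal_inf_tmp => _ [t [t0 _] <-]; rewrite lee_fin. Qed.

Lemma right_inverse_le s t : (0 <= t)%R -> s%:E < Phi t -> rinv Phi s <= t%:E.
Proof. by move=> t0 st; apply: ereal_inf_lbound; exists t. Qed.

Lemma right_inverse_ge s x :
  (forall t, (0 <= t)%R -> s%:E < Phi t -> x <= t%:E) -> x <= rinv Phi s.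
Proof. by move=> H; apply: le_ereal_inf_tmp => _ [t [t0 st] <-]; exact: H. Qed.

Lemma lt_right_inverse s t : (0 <= t)%R -> t%:E < rinv Phi s ->
  Phi t <= s%:E.
Proof. by move=> t0; rewrite !ltNge; apply: contraNle => st; exact: right_inverse_le. Qed.

Lemma right_inverse_lt s x : rinv Phi s < x ->
  exists t, [/\ (0 <= t)%R, t%:E < x & s%:E < Phi t].
Proof. by move=> /ereal_inf_lt[_ [t [t0 st] <-] tx]; exists t. Qed.

Lemma right_inverse_homo : {homo rinv Phi : s t / (s <= t)%R >-> s <= t}.
Proof.
move=> s t st; apply: right_inverse_ge => u u0 tu; apply: right_inverse_le => //.
by apply: le_lt_trans tu; rewrite lee_fin.
Qed.

End RightInverse.

(** * Comparison of a function with its integral against ds/s *)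

Section IntegralOfInverse.
Local Open Scope ereal_scope.
Context {R : realType} (phi : R -> \bar R).
Hypothesis phi0 : forall s, 0 <= phi s.

Let ge0_quot (t s : R) : `]0%R, t[%classic s -> 0 <= phi s / s%:E.
Proof. by rewrite /= in_itv/= => /andP[s0 _]; rewrite mule_ge0// inve_ge0 lee_fin ltW. Qed.

(** The integrand is at most the constant [tau / T] on an interval of length [T]. Together with the
    next lemma it removes the integrals from the definitions of [A_young] and [B_young]. *)
Lemma integral0_linear_le (T tau : R) : (0 < T)%R ->
  (forall s, (0 < s < T)%R -> phi s <= (tau * (s / T))%:E) ->
  Defs.integral0 T (fun s => phi s / s%:E) <= tau%:E.
Proof.
move=> T0 H; apply: le_trans (_ : (tau / T)%:E * lebesgue_measure `]0%R, T[%classic <= _).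
  apply: integral_le_cst => //; first exact: ge0_quot.
  move=> s /=; rewrite in_itv/= => sT; have /andP[s0 _] := sT.
  rewrite inver gt_eqF// lee_pdivrMr// -EFinM (le_trans (H _ sT))// lee_fin.
  by rewrite mulrA mulrAC.
by rewrite lebesgue_measure_itv/= lte_fin T0 oppr0 adde0 -EFinM divfK// gt_eqF.
Qed.

(** On [[r, 2r)], an interval of length [r], the integrand is at least [phi r / (2 * r)]. *)
Lemma le_integral0_double (r : R) : (0 < r)%R ->
  {homo phi : s t / (s <= t)%R >-> s <= t} ->
  phi r <= 2%:E * Defs.integral0 (2 * r) (fun s => phi s / s%:E).
Proof.
move=> r0 hphi; have r20 : (0 < 2 * r)%R by rewrite mulr_gt0.
have H : phi r / (2 * r)%:E * lebesgue_measure `[r, (2 * r)%R[%classic <=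
    Defs.integral0 (2 * r) (fun s => phi s / s%:E).
  apply: integral_ge_cst => //.
  - by move=> s /=; rewrite !in_itv/= => /andP[rs ->]; rewrite (lt_le_trans r0).
  - by rewrite mule_ge0// inve_ge0 lee_fin ltW.
  - exact: ge0_quot.
  move=> s /=; rewrite in_itv/= => /andP[rs s2]; have s0 := lt_le_trans r0 rs.
  apply: lee_pmul => //; first by rewrite inve_ge0 lee_fin ltW.
    exact: hphi.
  by rewrite !inver !gt_eqF// lee_fin lef_pV2// ?posrE// ltW.
rewrite -lee_pdivrMl//; apply: le_trans H.
rewrite lebesgue_measure_itv/= lte_fin ltr_pMl// ltr1n inver gt_eqF// -EFinB -muleA -EFinM.
by rewrite muleC le_eqVlt; apply/orP; left; apply/eqP; congr (_ * _%:E); field; rewrite gt_eqF.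
Qed.

End IntegralOfInverse.

(** * Exponents and the functions [B_integral] and [F_fun] *)

Section FractionalExponents.
Local Open Scope ereal_scope.
Context {R : realType} (n : nat) (gamma : R).
Hypothesis hg : (0 < gamma < n%:R)%R.

Local Notation al := (gamma / n%:R)%R.
Local Notation q := (@target_exp R n gamma).

Let n0 : (0 < n%:R :> R)%R. Proof. by case/andP: hg; exact: lt_trans. Qed.

Lemma dim_gt0 : (0 < n)%N. Proof. by move: n0; rewrite ltr0n. Qed.

Lemma order_ratio_gt0 : (0 < al)%R.
Proof. by case/andP: hg => g0 _; rewrite divr_gt0. Qed.

Lemma order_ratio_lt1 : (al < 1)%R.
Proof. by case/andP: hg => _ gn; rewrite ltr_pdivrMr// mul1r. Qed.

Lemma target_exp_gt1 : (1 < q)%R.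
Proof.
by case/andP: hg => g0 gn; rewrite /target_exp ltr_pdivlMr ?subr_gt0// mul1r gtrBl.
Qed.

Lemma target_exp_gt0 : (0 < q)%R.
Proof. exact: lt_trans ltr01 target_exp_gt1. Qed.

Lemma target_exp_conj : (q * (1 - al) = 1)%R.
Proof.
case/andP: hg => g0 gn; rewrite /target_exp; field.
by rewrite gt_eqF//= gt_eqF// subr_gt0.
Qed.

Lemma target_exp_step : (1 + al * q = q)%R.
Proof. by have := target_exp_conj; rewrite mulrBr mulr1 [(q * _)%R]mulrC; lra. Qed.

Section RangeFunction.
Context (B : R -> \bar R) (yB : young_function B).

Local Notation F := (F_fun n gamma B).
Local Notation Psi := (B_integral n gamma B).

Let integrand_ge0 (s : R) : (0 < s)%R -> 0 <= B s / (s `^ (q + 1))%:E.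
Proof.
by move=> s0; rewrite mule_ge0 ?(young_ge0 yB) ?inve_ge0 ?lee_fin ?powR_ge0// ltW.
Qed.

(** By monotonicity the superlevel sets of [B] inside []0, t[] are intervals. *)
Lemma measurable_young (t : R) : measurable_fun `]0%R, t[ B.
Proof.
apply: (measurability _ (ErealGenCInfty.measurableE R)) => _ [_ [y ->] <-].
apply: is_interval_measurable => s u /=.
rewrite !in_itv/= !andbT => -[/andP[s0 st] ys] [/andP[u0 ut] yu] v /andP[sv vu].
rewrite !in_itv/= (lt_le_trans s0 sv) (le_lt_trans vu ut); split => //.
by rewrite andbT; apply: le_trans ys _; apply: young_le => //; exact: ltW.
Qed.

Let measurable_integrand (t : R) :
  measurable_fun `]0%R, t[ (fun s => B s / (s `^ (q + 1))%:E).
Proof.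
apply: emeasurable_funM; first exact: measurable_young.
apply: (@eq_measurable_fun _ _ _ _ _ (fun s => (s `^ (- (q + 1)))%:E)).
  move=> s; rewrite inE/= in_itv/= => /andP[s0 _].
  by rewrite powRN inver gt_eqF// powR_gt0.
apply/measurable_EFinP; apply: measurable_funTS; exact: measurable_powR.
Qed.

Lemma B_integral_ge0 t : 0 <= Psi t.
Proof. by apply: integral_ge0 => s /=; rewrite in_itv/= => /andP[/integrand_ge0]. Qed.

Lemma F_fun_ge0 t : 0 <= F t.
Proof. by rewrite mule_ge0 ?lee_fin ?powR_ge0 ?B_integral_ge0. Qed.

Lemma B_integral_le s t : (s <= t)%R -> Psi s <= Psi t.
Proof.
move=> st; apply: le_integral_set_ge0.
  by move=> x /=; rewrite in_itv/= => /andP[/integrand_ge0].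
by apply: subset_itv; rewrite bnd_simp.
Qed.

Lemma F_fun_le s t : (0 <= s)%R -> (s <= t)%R -> F s <= F t.
Proof.
move=> s0 st; apply: lee_pmul; rewrite ?lee_fin ?powR_ge0 ?B_integral_ge0 ?B_integral_le//.
by rewrite ge0_ler_powR ?nnegrE ?(ltW target_exp_gt0)// (le_trans s0).
Qed.

Lemma F_fun_contract (eta x : R) : (0 <= eta <= 1)%R -> (0 <= x)%R ->
  F (eta * x) <= (eta `^ q)%:E * F x.
Proof.
move=> /andP[e0 e1] x0; rewrite /F_fun muleA -EFinM -powRM//.
apply: lee_pmul; rewrite ?lee_fin ?powR_ge0 ?B_integral_ge0 ?B_integral_le//.
by rewrite ler_piMl.
Qed.

(** The piece over [[x, 2x)] is at least [B x] times the length [x] times [(2x)^-(q+1)]. This lower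
    bound for an increment of the integral is what makes the dyadic sums telescope later. *)
Lemma B_integral_double (x : R) : (0 < x)%R ->
  Psi x + (2^-1 * (2 * x) `^ (- q))%:E * B x <= Psi (2 * x).
Proof.
move=> x0; have x20 : (0 < 2 * x)%R by rewrite mulr_gt0.
have x2x : (x <= 2 * x)%R by rewrite ler_peMl ?ler1n// ltW.
have U : `]0%R, (2 * x)%R[%classic =
    (`]0%R, x[%classic `|` `[x, (2 * x)%R[%classic) :> set R.
  by rewrite -itv_bndbnd_setU// bnd_simp.
rewrite /B_integral /Defs.integral0 U ge0_integral_setU//; last 3 first.
- by rewrite -U; exact: measurable_integrand.
- by move=> s; rewrite -U /= in_itv/= => /andP[/integrand_ge0].
- apply/disj_setPS => s /=; rewrite !in_itv/= => -[/andP[_ sx] /andP[xs _]].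
  by move: sx; rewrite ltNge xs.
rewrite leeD2l//.
have H : ((2 * x) `^ (- (q + 1)))%:E * B x * lebesgue_measure `[x, (2 * x)%R[%classic
    <= \int[lebesgue_measure]_(s in `[x, (2 * x)%R[) (B s / (s `^ (q + 1))%:E).
  apply: integral_ge_cst => //.
  - by rewrite mule_ge0 ?lee_fin ?powR_ge0 ?(young_ge0 yB)// ltW.
  - by move=> s /=; rewrite in_itv/= => /andP[xs _]; apply: integrand_ge0; exact: lt_le_trans xs.
  move=> s /=; rewrite in_itv/= => /andP[xs s2]; have s0 := lt_le_trans x0 xs.
  rewrite muleC lee_pmul ?lee_fin ?powR_ge0 ?(young_ge0 yB) ?(ltW x0)//.
    by apply: young_le => //; exact: ltW.
  rewrite inver gt_eqF ?powR_gt0// lee_fin powRN lef_pV2 ?posrE ?powR_gt0//.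
  have q0 : (0 <= q + 1)%R by rewrite addr_ge0// ltW// target_exp_gt0.
  by rewrite ge0_ler_powR// ?nnegrE ltW.
apply: le_trans H; rewrite lebesgue_measure_itv/= lte_fin ltr_pMl// ltr1n -EFinB.
rewrite muleAC -EFinM lee_wpmul2r ?(young_ge0 yB) ?(ltW x0)// lee_fin opprD.
rewrite powRD ?(gt_eqF x20) ?implybT//.
by rewrite powR_inv1 ?(ltW x20)// le_eqVlt; apply/orP; left; apply/eqP; field; rewrite gt_eqF.
Qed.

Lemma le_F_fun_double (x : R) : (0 < x)%R -> B x <= 2%:E * F (2 * x).
Proof.
move=> x0; have x20 : (0 < 2 * x)%R by rewrite mulr_gt0.
have := B_integral_double x0; rewrite -lee_pdivrMl// => H.
have : (2^-1 * (2 * x) `^ (- q))%:E * B x <= Psi (2 * x).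
  by apply: le_trans H; rewrite leeDr// B_integral_ge0.
rewrite /F_fun powRN => /(lee_wpmul2l (_ : 0 <= ((2 * x) `^ q)%:E)) /=.
rewrite lee_fin powR_ge0 => /(_ isT); apply: le_trans.
by rewrite muleA -EFinM mulrCA divff ?mulr1// gt_eqF// powR_gt0.
Qed.

Lemma F_fun_unbounded (M : R) : exists2 x : R, (0 < x)%R & M%:E < F x.
Proof.
have [t t0 Mt] := young_unbounded yB (2 * M)%R.
exists (2 * t)%R; first exact: mulr_gt0.
have := lt_le_trans Mt (le_F_fun_double t0).
by rewrite EFinM lte_pmul2l.
Qed.

End RangeFunction.
End FractionalExponents.

(** * The core inequality and its equivalence with (iii) and (iv) *)

Section Core.
Local Open Scope ereal_scope.
Context {R : realType} (n : nat) (gamma : R).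
Hypothesis hg : (0 < gamma < n%:R)%R.

Local Notation al := (gamma / n%:R)%R.
Local Notation q := (@target_exp R n gamma).
Local Notation F := (F_fun n gamma).

Let al0 : (0 < al)%R. Proof. exact: order_ratio_gt0. Qed.
Let al1 : (al < 1)%R. Proof. exact: order_ratio_lt1. Qed.
Let q1 : (1 < q)%R. Proof. exact: target_exp_gt1. Qed.
Let q0 : (0 < q)%R. Proof. exact: target_exp_gt0. Qed.

Definition core_ineq (A B : R -> \bar R) (C : R) :=
  forall a tau : R, (0 < a)%R -> (0 < tau)%R -> A a <= tau%:E ->
    F B (a * tau `^ (- al) / C)%R <= tau%:E.

Context (A B : R -> \bar R) (yA : young_function A) (yB : young_function B).

(** Shrinking the argument by [K] gains [K^-q <= K^-1], because [q > 1]; this cancels the factor [K]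
    on the right. *)
Lemma core_ineq_absorb (C K : R) : (0 < C)%R -> (1 <= K)%R ->
  (forall a tau : R, (0 < a)%R -> (0 < tau)%R -> A a <= tau%:E ->
    F B (a * tau `^ (- al) / C)%R <= (K * tau)%:E) ->
  core_ineq A B (K * C).
Proof.
move=> C0 K1 H a tau a0 tau0 Aa; have K0 := lt_le_trans ltr01 K1.
have -> : (a * tau `^ (- al) / (K * C) = K^-1 * (a * tau `^ (- al) / C))%R.
  by field; rewrite !gt_eqF.
apply: le_trans (F_fun_contract n gamma yB _ _) _.
- by rewrite invr_ge0 ltW//= invf_le1.
- by rewrite divr_ge0 ?mulr_ge0 ?powR_ge0 ?ltW//.
apply: le_trans (lee_wpmul2l _ (H _ _ a0 tau0 Aa)) _.
  by rewrite lee_fin powR_ge0.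
have Kq : (K^-1 `^ q <= K^-1)%R.
  by rewrite -[leRHS]powRr1 ?invr_ge0 ?(ltW K0)// ger_powR ?(ltW q1)// invr_gt0 K0 invf_le1.
rewrite -EFinM lee_fin mulrA ler_piMl ?(ltW tau0)//.
by apply: le_trans (ler_wpM2r (ltW K0) Kq) _; rewrite mulVf ?gt_eqF.
Qed.

Variable C : R.
Hypothesis C0 : (0 < C)%R.

(** Fix [b] with [F b > 1]. If [A a <= tau < 1], core gives [F (a tau^(-al) / C) <= tau < F b], so
    [a tau^(-al) / C < b], a lower bound for [tau] of order [a^(1/al)]. This provides both [A_cond]
    and the positivity of [A]. *)
Lemma core_ineq_growth : core_ineq A B C ->
  exists2 k : R, (0 < k)%R & forall a, (0 < a)%R ->
    (Num.min 1 (k * a `^ al^-1))%:E <= A a.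
Proof.
move=> H; have [b b0 Fb] := F_fun_unbounded hg yB 1.
have Cb0 : (0 < C * b)%R by exact: mulr_gt0.
exists ((C * b) `^ (- al^-1))%R; first exact: powR_gt0.
move=> a a0; rewrite leNgt; apply/negP => Aa.
have k0 : (0 < (C * b) `^ (- al^-1) * a `^ al^-1)%R by rewrite mulr_gt0 ?powR_gt0.
have [v Av] : exists v : R, A a = v%:E.
  have := young_ge0 yA (ltW a0); move: Aa.
  by case: (A a) => // v _ _; exists v.
move: Aa; rewrite Av lte_fin => vm.
have v0 : (0 <= v)%R by rewrite -lee_fin -Av (young_ge0 yA) ?ltW.
(* Core requires [tau > 0] whereas [A a] may be 0, so [tau] is taken strictly above [A a]. *)
have [tau /andP[vtau]] : exists tau, (v < tau < Num.min 1 ((C * b) `^ (- al^-1) * a `^ al^-1))%R.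
  by move: vm; set m := Num.min _ _ => vm; exists ((v + m) / 2)%R; apply/andP; split; lra.
rewrite lt_min => /andP[tau1 tauk].
have tau0 := le_lt_trans v0 vtau.
have := H _ _ a0 tau0; rewrite Av lee_fin (ltW vtau) => /(_ isT) Ftau.
have : (a * tau `^ (- al) / C < b)%R.
  rewrite ltNge; apply/negP => bx.
  have := lt_le_trans Fb (F_fun_le hg yB (ltW b0) bx).
  by move=> /lt_le_trans/(_ Ftau); rewrite lte_fin ltNge ltW.
rewrite ltr_pdivrMr// powRN ltr_pdivrMr ?powR_gt0// => ab.
have : (a `^ al^-1 < (b * C * tau `^ al) `^ al^-1)%R.
  by rewrite gt0_ltr_powR ?invr_gt0// nnegrE ?mulr_ge0 ?powR_ge0 ?ltW//.
rewrite powRM ?powR_ge0 ?mulr_ge0 ?(ltW b0) ?(ltW C0)// -powRrM divff ?gt_eqF// powRr1 ?ltW//.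
rewrite [(b * C)%R]mulrC -ltr_pdivrMl ?powR_gt0// -powRN => ktau.
by have := lt_trans ktau tauk; rewrite ltxx.
Qed.

Lemma core_ineq_pos : core_ineq A B C -> forall a, (0 < a)%R -> 0 < A a.
Proof.
move=> /core_ineq_growth[k k0 H] a a0; apply: lt_le_trans (H _ a0).
by rewrite lte_fin lt_min ltr01 mulr_gt0// powR_gt0.
Qed.

Lemma core_A_cond : core_ineq A B C -> A_cond n gamma A.
Proof.
move=> /core_ineq_growth[k k0 H].
apply: (@lt_le_trans _ _ (Num.min 1 k)%:E); first by rewrite lte_fin lt_min ltr01.
apply: le_ereal_inf_tmp => _ [t /= + <-]; rewrite in_itv/= => /andP[t0 t1].
have -> : (n%:R / gamma = al^-1)%R by rewrite invf_div.
rewrite powRN lee_pdivlMr ?powR_gt0// -EFinM; apply: le_trans (H _ t0).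
have t1' : (t `^ al^-1 <= 1)%R.
  apply: le_trans (ge0_ler_powR _ _ _ (ltW t1)) _;
    by rewrite ?nnegrE ?invr_ge0 ?powR1 ?ler01 ?(ltW t0) ?(ltW al0).
rewrite lee_fin le_min; apply/andP; split.
  by rewrite mulr_ile1 ?powR_ge0 ?le_min ?ler01 ?(ltW k0) ?ge_min ?lexx.
by rewrite ler_wpM2r ?powR_ge0// ge_min lexx orbT.
Qed.

Lemma F_fun_le_divE (t : R) (x : \bar R) : (0 < t)%R ->
  (B_integral n gamma B t <= x / (t `^ q)%:E) = (F B t <= x).
Proof.
move=> t0; rewrite inver gt_eqF ?powR_gt0// lee_pdivlMr ?powR_gt0//.
by rewrite muleC.
Qed.

(** With [g = a tau^(-al)], the point is [A_young (g / 2) <= tau]. For [0 < theta <= 1],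
    [A (theta a) <= theta tau], so the inverse of [A] at [theta tau] is at least [theta a] and
    [G (theta tau) >= theta g]. Halving [g] makes this strictly larger than [s = theta g / 2], as
    the right inverse demands. *)
Lemma domain_core : domain_ineq n gamma A B C -> core_ineq A B (2 * C).
Proof.
move=> [_ H] a tau a0 tau0 Aa; set g := (a * tau `^ (- al))%R.
have g0 : (0 < g)%R by rewrite mulr_gt0 ?powR_gt0.
have gC0 : (0 < g / (2 * C))%R by rewrite divr_gt0// mulr_gt0.
have := H _ gC0; rewrite F_fun_le_divE// => Fg; apply: (le_trans Fg) => {Fg}.
have -> : (C * (g / (2 * C)) = g / 2)%R by field; rewrite gt_eqF.
have g20 : (0 < g / 2)%R by rewrite divr_gt0.
rewrite /A_young; apply: (integral0_linear_le (right_inverse_ge0 _) g20).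
move=> s /andP[s0 sg]; set theta := (s / (g / 2))%R.
have theta0 : (0 < theta)%R by rewrite divr_gt0.
have theta1 : (theta <= 1)%R by rewrite ler_pdivrMr ?mul1r ?ltW.
have thg : (theta * g = s + s)%R by rewrite /theta; field; rewrite gt_eqF.
clearbody theta; have tt0 : (0 < theta * tau)%R by rewrite mulr_gt0.
rewrite [(tau * _)%R]mulrC; apply: right_inverse_le; first exact: ltW.
rewrite /G_fun gt_eqF//; apply: (@lt_le_trans _ _ (theta * g)%:E).
  by rewrite thg lte_fin ltrDl.
apply: le_trans (_ : (theta * a)%:E * ((theta * tau) `^ (- al))%:E <= _).
  rewrite -EFinM lee_fin /g powRM ?(ltW theta0) ?(ltW tau0)// -!mulrA ler_wpM2l ?(ltW theta0)//.
  rewrite ler_wpM2l ?(ltW a0)// ler_peMl ?powR_ge0//.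
  by rewrite -[leLHS](powRr0 theta) ger_powR ?theta0 ?theta1// oppr_le0 ltW.
apply: ereal_sup_ge; exists (rinv A (theta * tau) * ((theta * tau) `^ (- al))%:E).
  by exists (theta * tau)%R => //=; rewrite in_itv/= tt0 lexx.
apply: lee_wpmul2r; first by rewrite lee_fin powR_ge0.
apply: right_inverse_ge => t t0 Att; rewrite lee_fin leNgt; apply/negP => ta.
have := lt_le_trans Att (young_le yA t0 (ltW ta)); rewrite ltNge => /negP; apply.
apply: le_trans (young_contract yA (ltW a0) _) _; first by rewrite (ltW theta0).
by rewrite EFinM lee_wpmul2l// lee_fin ltW.
Qed.

(** If [G tau > t], some [s <= tau] satisfies [A (t s^al) <= s], and core at that point reads
    [F (t / C) <= s]; this is [key]. The constant comes from [F t <= F (2t) / 2], whose factor 1/2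
    offsets the 2 of [le_integral0_double] taken at [2 C t]. *)
Lemma core_domain : core_ineq A B C -> domain_ineq n gamma A B (4 * C).
Proof.
move=> H; split; first exact: core_A_cond.
have key t : (0 < t)%R -> F B (t / C) <= rinv (G_fun n gamma A) t.
  move=> t0; apply: right_inverse_ge => tau tau0; rewrite /G_fun; case: ifPn => [_|].
    by rewrite lte_fin ltNge ltW.
  move=> _ /ereal_sup_gt[z [s /=]]; rewrite in_itv/= => /andP[s0 stau] <- {z}.
  rewrite powRN lte_pdivlMr ?powR_gt0// -EFinM => ts.
  apply: (@le_trans _ _ s%:E); last by rewrite lee_fin.
  have a0 : (0 < t * s `^ al)%R by rewrite mulr_gt0 ?powR_gt0.
  have := H _ _ a0 s0; rewrite powRN mulfK ?gt_eqF ?powR_gt0//; apply.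
  by apply: lt_right_inverse ts; rewrite ltW.
move=> t t0; rewrite F_fun_le_divE//.
have t20 : (0 < 2 * C * t)%R by rewrite !mulr_gt0.
have -> : t = (2^-1 * (2 * C * t / C))%R by field; rewrite gt_eqF.
have tC0 : (0 < 2 * C * t / C)%R by rewrite divr_gt0.
apply: le_trans (F_fun_contract n gamma yB _ (ltW tC0)) _;
  first by rewrite invr_ge0 ler0n/= invf_le1// ler1n.
apply: (@le_trans _ _ ((2^-1)%:E * F B (2 * C * t / C))).
  apply: lee_wpmul2r; first exact: F_fun_ge0.
  by rewrite lee_fin -[leRHS]powRr1// ger_powR ?(ltW q1)// invr_gt0 ltr0n/= invf_le1// ler1n.
rewrite lee_pdivrMl//; apply: le_trans (key _ t20) _.
apply: le_trans (le_integral0_double _ t20 _) _;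
  [exact: right_inverse_ge0|exact: right_inverse_homo|].
by apply: lee_wpmul2l => //; rewrite le_eqVlt; apply/orP; left; apply/eqP;
  congr (A_young _ _ _ _); field; rewrite gt_eqF.
Qed.

(** At [r = a / (2C)] the inverse of [E] is at most [2 B_young (a / C) <= 2 tau < 3 tau], so some
    [sigma < 3 tau] has [E sigma > r], which unfolds to [F (sigma^(-al) r) <= sigma]. Replacing
    [sigma] by [3 tau] costs at most 3 inside [F] (as [al < 1]) and 3 outside; the outer one is
    absorbed. *)
Lemma range_core : range_ineq n gamma A B C -> core_ineq A B (3 * (6 * C)).
Proof.
move=> [_ H]; have C60 : (0 < 6 * C)%R by rewrite mulr_gt0.
apply: core_ineq_absorb; rewrite ?ler1n//.
move=> a tau a0 tau0 Aa; pose r := (a / (2 * C))%R.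
have r0 : (0 < r)%R by rewrite divr_gt0// mulr_gt0.
have Er : rinv (E_fun n gamma B) r < (3 * tau)%:E.
  apply: le_lt_trans (le_integral0_double (right_inverse_ge0 _) r0 (right_inverse_homo _)) _.
  have -> : (2 * r = a / C)%R by rewrite /r; field; rewrite gt_eqF.
  apply: le_lt_trans (lee_wpmul2l _ (H _ (divr_gt0 a0 C0))) _ => //.
  rewrite mulrC divfK ?gt_eqF//; apply: le_lt_trans (lee_wpmul2l _ Aa) _ => //.
  by rewrite -EFinM lte_fin ltr_pM2r// ltr_nat.
have [sigma [sigma0 sigmat Es]] := right_inverse_lt Er.
(* [E] vanishes at 0, while [E sigma > r > 0]. *)
have {}sigma0 : (0 < sigma)%R.
  rewrite lt_def sigma0 andbT; apply/eqP => s0; move: Es.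
  by rewrite /E_fun s0 powR0 ?gt_eqF// mul0e lte_fin ltNge ltW.
move: Es; rewrite /E_fun -lte_pdivrMl ?powR_gt0// -powRN -EFinM => Es.
have x0 : (0 <= sigma `^ (- al) * r)%R by rewrite mulr_ge0 ?powR_ge0 ?(ltW r0).
have {}Es := lt_right_inverse x0 Es.
apply: (@le_trans _ _ sigma%:E); last by rewrite lee_fin ltW.
apply: le_trans Es; apply: (F_fun_le hg yB).
  by rewrite divr_ge0 ?mulr_ge0 ?powR_ge0 ?ltW.
have -> : (a * tau `^ (- al) / (6 * C) = 3^-1 * tau `^ (- al) * r)%R.
  by rewrite /r; field; rewrite gt_eqF.
rewrite ler_wpM2r ?(ltW r0)//; apply: (@le_trans _ _ ((3 * tau) `^ (- al))%R).
  rewrite powRM ?(ltW tau0)// ler_wpM2r ?powR_ge0// -powR_inv1// ler_powR ?ler1n//.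
  by rewrite lerN2 ltW.
rewrite !powRN lef_pV2 ?posrE ?powR_gt0// ?mulr_gt0//.
by rewrite ge0_ler_powR ?nnegrE ?(ltW al0) ?(ltW sigma0) ?mulr_ge0 ?(ltW tau0)// ltW.
Qed.

(** Let [a = 2 C t], [tau = A a] and [x = a tau^(-al) / C]. As [(1 - al) q = 1], contraction gives
    [F (theta^(1-al) x) <= theta tau], so [E (theta tau) >= (theta tau)^al theta^(1-al) x = theta a
    / C], which is [2 s > s] for [theta = s / t]. *)
Lemma core_range : core_ineq A B C -> range_ineq n gamma A B (2 * C).
Proof.
move=> H; split.
  (* For convergence near zero, core is applied where [A] is finite; adding 1 to its value keeps
     [tau] positive. *)
  have [a a0 Aa] := young_fin_ex yA.
  have tau0 := fine_ge0 (young_ge0 yA (ltW a0)).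
  have tau1 : (0 < fine (A a) + 1)%R by rewrite ltr_pwDr.
  have := H _ _ a0 tau1; rewrite EFinD fineK ?ge0_fin_numE ?(young_ge0 yA) ?(ltW a0)//.
  rewrite leeDl// => /(_ isT); set x := (_ / C)%R => Fx.
  have x0 : (0 < x)%R by rewrite divr_gt0 ?mulr_gt0 ?powR_gt0.
  exists x => //; have Flty := le_lt_trans Fx (lte_add_pinfty Aa (ltry 1)).
  rewrite ltey; apply/eqP => Py; move: Flty.
  by rewrite /F_fun Py gt0_muley ?ltxx// lte_fin powR_gt0.
move=> t t0; set a := (2 * C * t)%R.
have a0 : (0 < a)%R by rewrite !mulr_gt0.
have [|/eqP Afin] := eqVneq (A a) +oo; first by move=> ->; rewrite leey.
have : 0 < A a by exact: core_ineq_pos.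
case E: (A a) Afin => [tau| |]// _; rewrite lte_fin => tau0.
rewrite /B_young; apply: (integral0_linear_le (right_inverse_ge0 _) t0).
move=> s /andP[s0 st]; set theta := (s / t)%R.
have theta0 : (0 < theta)%R by rewrite divr_gt0.
have theta1 : (theta <= 1)%R by rewrite ler_pdivrMr ?mul1r ?ltW.
have thg : (theta * (a / C) = s + s)%R by rewrite /theta /a; field; rewrite !gt_eqF.
clearbody theta; have tt0 : (0 < theta * tau)%R by rewrite mulr_gt0.
rewrite [(tau * _)%R]mulrC; apply: right_inverse_le; first exact: ltW.
apply: (@lt_le_trans _ _ (theta * (a / C))%:E); first by rewrite thg lte_fin ltrDl.
have xx : F B (a * tau `^ (- al) / C) <= tau%:E by apply: H; rewrite // E.
set x := (a * tau `^ (- al) / C)%R in xx.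
have x0 : (0 < x)%R by rewrite divr_gt0 ?mulr_gt0 ?powR_gt0.
have -> : (theta * (a / C) = (theta * tau) `^ al * (theta `^ (1 - al) * x))%R.
  rewrite /x powRM ?(ltW theta0) ?(ltW tau0)// powRN powRD ?(gt_eqF theta0) ?implybT//.
  rewrite powRN powRr1 ?(ltW theta0)//.
  by field; rewrite !gt_eqF ?powR_gt0.
rewrite EFinM /E_fun; apply: lee_wpmul2l; first by rewrite lee_fin powR_ge0.
apply: right_inverse_ge => u u0 Fu; rewrite lee_fin leNgt; apply/negP => ux.
have := lt_le_trans Fu (F_fun_le hg yB u0 (ltW ux)); rewrite ltNge => /negP; apply.
apply: le_trans (F_fun_contract n gamma yB _ (ltW x0)) _.
  rewrite powR_ge0/= -[leRHS](powRr0 theta) ger_powR ?theta0 ?theta1//.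
  by rewrite subr_ge0 ltW.
rewrite -powRrM [((1 - al) * q)%R]mulrC target_exp_conj// powRr1 ?(ltW theta0)// EFinM.
by rewrite lee_wpmul2l// lee_fin ltW.
Qed.

End Core.

(** * Dyadic brackets and geometrically decreasing sequences *)

Lemma powR_expr (R : realType) (x e : R) k : (0 <= x)%R ->
  ((x ^+ k) `^ e = (x `^ e) ^+ k)%R.
Proof.
move=> x0; elim: k => [|k IH]; first by rewrite !expr0 powR1.
by rewrite !exprS powRM ?exprn_ge0// IH.
Qed.

Lemma dyadic_bracket (R : realType) (u s : R) : (0 < s < u)%R ->
  exists k : nat, (u / 2 ^+ k.+1 <= s < u / 2 ^+ k)%R.
Proof.
move=> /andP[s0 su].
have ex : exists k : nat, (u / 2 ^+ k.+1 <= s)%R.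
  exists (Num.bound (u / s)); set k := Num.bound _.
  have usk : (u / s <= k%:R)%R.
    by apply/ltW/archi_boundP; rewrite divr_ge0// ltW// (lt_trans s0).
  rewrite ler_pdivrMr ?exprn_gt0// mulrC -ler_pdivrMr//; apply: (le_trans usk).
  by rewrite -natrX ler_nat (leq_trans (ltnW (ltn_expl k (isT : 1 < 2)%N)))// leq_exp2l.
case: (ex_minnP ex) => k ks kmin; exists k; rewrite ks /=.
case: k ks kmin => [|k] ks kmin; first by rewrite expr0 divr1.
by rewrite ltNge; apply/negP => /kmin; rewrite ltnn.
Qed.

Section HalvingSums.
Local Open Scope ereal_scope.
Context {R : realType}.
Implicit Types b : nat -> \bar R.

Lemma sum_halves_le b N : (forall k, 0 <= b k) ->
  (forall k, b k.+1 <= (2^-1)%:E * b k) ->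
  \sum_(k < N) (2^-1)%:E * b k <= b 0%N.
Proof.
elim: N b => [|N IH] b b0 bS; first by rewrite big_ord0.
rewrite big_ord_recl; apply: le_trans (leeD2l _ (IH (b \o S) _ _)) _ => [k|k|/=].
- exact: b0.
- exact: bS.
apply: le_trans (leeD2l _ (bS _)) _; rewrite -ge0_muleDl ?lee_fin//.
by rewrite -EFinD (_ : 2^-1 + 2^-1 = 1)%R ?mul1e//; lra.
Qed.

(** The first selected index carries the largest selected term and the geometric decay bounds the
    whole tail by it; the induction discards the unselected indices before it. *)
Lemma sum_halves_indic_le b (s : nat -> bool) (beta : \bar R) N :
  (forall k, 0 <= b k) -> (forall k, b k.+1 <= (2^-1)%:E * b k) ->
  0 <= beta -> (forall k, s k -> b k <= beta) ->
  \sum_(k < N) (2^-1)%:E * b k * (s k)%:R%:E <= beta.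
Proof.
move=> + + beta0; elim: N b s => [|N IH] b s b0 bS sb; first by rewrite big_ord0.
case s0: (s 0%N).
  apply: le_trans (sb _ s0); apply: le_trans (sum_halves_le N.+1 b0 bS).
  apply: lee_sum => k _; case: (s k); rewrite ?mule1 ?mule0//.
  by rewrite mule_ge0// lee_fin.
rewrite big_ord_recl s0 mule0 add0e.
exact: (IH (b \o S) (s \o S) (fun k => b0 k.+1) (fun k => bS k.+1) (fun k => sb k.+1)).
Qed.

End HalvingSums.

(** * From the modular to the norm inequality, and from there to the core *)

Section NormInequality.
Local Open Scope ereal_scope.
Context {R : realType} (n : nat) (gamma : R).
Hypothesis hg : (0 < gamma < n%:R)%R.

Local Notation al := (gamma / n%:R)%R.
Local Notation q := (@target_exp R n gamma).
Local Notation F := (F_fun n gamma).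
Local Notation mu := (lebesgue R n).
Local Notation M := (frac_maximal gamma).

Let al0 : (0 < al)%R. Proof. exact: order_ratio_gt0. Qed.
Let q0 : (0 < q)%R. Proof. exact: target_exp_gt0. Qed.

Lemma frac_maximal_ge (f : euclidean R n -> \bar R) (a : 'I_n -> R) (l : R) x :
  (0 < l)%R -> cube a l x ->
  mu (cube a l) `^ (al - 1)%R * \int[mu]_(y in cube a l) `|f y| <= M f x.
Proof.
move=> l0 xQ; apply: ereal_sup_ubound; exists (cube a l) => //; split => //.
exact: is_cube_cube.
Qed.

Lemma frac_maximal_ge0 (f : euclidean R n -> \bar R) x : 0 <= M f x.
Proof.
apply: le_trans (frac_maximal_ge f (a := fun i => eucl_coord x i) ltr01 _).
  by rewrite mule_ge0 ?poweR_ge0 ?integral_ge0.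
by move=> i; rewrite lexx lerDl ler01.
Qed.

Context (A B : R -> \bar R) (yA : young_function A) (yB : young_function B).
Variable C : R.
Hypothesis C0 : (0 < C)%R.

(** For every admissible [lam] the function [g = f / lam] has modular at most 1, so the normalizing
    power of the modular in (ii) is at most 1 and may be dropped. *)
Lemma modular_norm : modular_ineq n gamma A B C -> norm_ineq n gamma A B C.
Proof.
move=> H f fA; have [mf _] := fA.
rewrite -lee_pdivrMl//; apply: le_ereal_inf_tmp => _ [lam [lam0 Ilam] <-].
rewrite lee_pdivrMl// -EFinM; apply: ereal_inf_lbound; exists (C * lam)%R => //=.
split; first exact: mulr_gt0.
pose g x := f x * lam^-1%:E.
have lamV0 : (0 <= lam^-1)%R by rewrite invr_ge0 ltW.
have absg x : `|g x| = `|f x| / lam%:E.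
  by rewrite /g abseM inver (gt_eqF lam0) (@gee0_abs _ lam^-1%:E).
have Ig : \int[mu]_x young_ext A `|g x| <= 1.
  by under eq_integral do rewrite absg.
have gA : in_orlicz A g.
  split; first by apply: emeasurable_funM.
  exists 1%R => //; apply: le_lt_trans (ltry 1).
  by under eq_integral do rewrite inve1 mule1.
have Mg x : M f x <= lam%:E * M g x.
  apply: ge_ereal_sup => _ [Q [[a [l [l0 ->]] xQ] <-]].
  have -> : \int[mu]_(y in cube a l) `|f y| =
      lam%:E * \int[mu]_(y in cube a l) `|g y|.
    rewrite -ge0_integralZl; last 4 first.
    - exact: measurable_cube.
    - by apply: measurableT_comp => //; apply: measurable_funTS; case: gA.
    - by move=> y _; exact: abse_ge0.
    - by rewrite lee_fin ltW.
    apply: eq_integral => y _; rewrite absg inver (gt_eqF lam0) muleCA -EFinM.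
    by rewrite divff ?mule1// gt_eqF.
  rewrite muleCA lee_wpmul2l ?lee_fin ?(ltW lam0)//.
  exact: (frac_maximal_ge g l0 xQ).
apply: le_trans (Ig); apply: le_trans (H _ gA).
apply: le_integral_ge0 => x _.
  by apply: young_ext_ge0 => //; rewrite mule_ge0// inve_ge0 lee_fin mulr_ge0// ltW.
apply: young_ext_le => //.
  by rewrite mule_ge0// inve_ge0 lee_fin mulr_ge0// ltW.
rewrite gee0_abs ?frac_maximal_ge0//.
have IA0 : 0 <= \int[mu]_y young_ext A `|g y|.
  by apply: integral_ge0 => y _; exact: young_ext_ge0.
apply: (@le_trans _ _ (M g x / C%:E)).
  rewrite !inver !gt_eqF ?mulr_gt0// invfM mulrC EFinM muleA.
  by rewrite lee_wpmul2r ?lee_fin ?invr_ge0 ?(ltW C0)// lee_pdivrMr// muleC.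
apply: lee_wpmul2l; first exact: frac_maximal_ge0.
(* Inversion is antitone on [[0, +oo]] with the inverse of 0 equal to [+oo], so a vanishing modular
   is covered as well. *)
rewrite lee_pV2 ?inE ?mule_ge0 ?poweR_ge0 ?lee_fin ?(ltW C0)//.
rewrite -[leRHS]mule1 lee_wpmul2l ?lee_fin ?(ltW C0)//.
rewrite -(poweR1r al); apply: gt0_ler_poweR;
  by rewrite ?(ltW al0) ?in_itv/= ?IA0 ?leey ?lee_fin ?ler01.
Qed.

Lemma norm_core : norm_ineq n gamma A B C ->
  core_ineq n gamma A B (2 `^ (q + 1) * (2 * C)).
Proof.
move=> H; apply: core_ineq_absorb => //; first exact: mulr_gt0.
  by rewrite -[leLHS](powRr0 2) ler_powR ?ler1n// addr_ge0// ltW.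
move=> a tau a0 tau0 Aa; have n_gt0 : (0 < n%:R :> R)%R by rewrite ltr0n (dim_gt0 hg).
have ng0 : (0 < n%:R - gamma)%R by case/andP: hg => _; rewrite subr_gt0.
pose l := (tau `^ (- n%:R^-1))%R; have l0 : (0 < l)%R by exact: powR_gt0.
have ln : (l ^+ n = tau^-1)%R.
  rewrite -powR_mulrn ?(ltW l0)// -powRrM mulNr mulVf ?gt_eqF//.
  by rewrite powR_inv1 ?(ltW tau0).
(* This ratio satisfies [rho^n = 2^q], so each dilation multiplies the measure by [2^q] and its
   power [al - 1] by exactly 1/2. *)
pose rho := (2 `^ (n%:R - gamma)^-1 : R)%R; have rho0 : (0 < rho)%R by exact: powR_gt0.
have rho1 : (1 <= rho)%R by rewrite -[leLHS](powRr0 2) ler_powR ?ler1n// invr_ge0 ltW.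
have rhon : (rho ^+ n = 2 `^ q)%R.
  by rewrite -powR_mulrn ?(ltW rho0)// -powRrM mulrC.
pose L k := (l * rho ^+ k)%R; have L0 k : (0 < L k)%R by rewrite mulr_gt0 ?exprn_gt0.
pose Q k := cube (fun _ : 'I_n => 0%R) (L k).
have muQ k : mu (Q k) = (tau^-1 * (2 `^ q) ^+ k)%:E.
  by rewrite lebesgue_cube ?(ltW (L0 k))// /L exprMn ln -exprM mulnC exprM rhon.
pose f (x : euclidean R n) : \bar R := a%:E * (\1_(Q 0%N) x)%:E.
have mf : measurable_fun setT f.
  apply: emeasurable_funM; first exact: measurable_cst.
  apply/measurable_EFinP; exact/measurable_indic/measurable_cube.
have f0 x : 0 <= f x by rewrite mule_ge0 ?lee_fin// ltW.
have If : \int[mu]_x young_ext A (`|f x| / 1%:E) <= 1.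
  rewrite (eq_integral (fun x => A a * (\1_(Q 0%N) x)%:E)); last first.
    move=> x _; rewrite inve1 mule1 gee0_abs// /f indicE.
    by case: (x \in Q 0%N); rewrite ?mule1 ?mule0//= young0.
  rewrite integral_mul_indic ?(young_ge0 yA) ?(ltW a0)//; last exact: measurable_cube.
  by rewrite muQ expr0 mulr1 lee_pdivrMr// mul1e.
have fA : in_orlicz A f by split=> //; exists 1%R => //; apply: le_lt_trans (ltry 1).
(* The Luxemburg norm is an infimum that need not be attained; passing from [C] to [2 C] yields an
   actual admissible [lam]. *)
have [lam [lam0 Ilam lamC]] : exists lam, [/\ (0 < lam)%R,
    \int[mu]_x young_ext B (`|M f x| / lam%:E) <= 1 & (lam < 2 * C)%R].
  have : luxemburg B (M f) < (2 * C)%:E.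
    apply: le_lt_trans (H _ fA) _; apply: (@le_lt_trans _ _ C%:E).
      rewrite -[leRHS]mule1 lee_wpmul2l ?lee_fin ?(ltW C0)//.
      by apply: ereal_inf_lbound; exists 1%R.
    by rewrite lte_fin ltr_pMl// ltr1n.
  by move=> /ereal_inf_lt[_ [lam [lam0 Ilam] <-]] lamC; exists lam.
set u := (a * tau `^ (- al) / (2 * C))%R.
have u0 : (0 < u)%R by rewrite divr_gt0 ?mulr_gt0 ?powR_gt0.
pose b k := B (u / 2 ^+ k)%R.
have uk0 k : (0 < u / 2 ^+ k)%R by rewrite divr_gt0 ?exprn_gt0.
have b0 k : 0 <= b k by rewrite (young_ge0 yB)// ltW.
have bS k : b k.+1 <= (2^-1)%:E * b k.
  rewrite /b exprS invfM mulrCA; apply: young_contract => //; first exact: ltW.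
  by rewrite invr_ge0 ler0n/= invf_le1// ler1n.
pose beta x := young_ext B (`|M f x| / lam%:E).
have beta0 x : 0 <= beta x.
  by apply: young_ext_ge0 => //; rewrite mule_ge0// inve_ge0 lee_fin ltW.
have Qbeta x k : Q k x -> b k <= beta x.
  move=> xQ; rewrite (_ : b k = young_ext B (u / 2 ^+ k)%:E)//; apply: young_ext_le => //.
    by rewrite lee_fin ltW.
  rewrite gee0_abs ?frac_maximal_ge0// inver (gt_eqF lam0) lee_pdivlMr//.
  apply: le_trans (frac_maximal_ge f (L0 k) xQ).
  have Q0k : Q 0%N `<=` Q k.
    move=> y yQ i; have /andP[-> /le_trans] := yQ i; apply.
    by rewrite !add0r ler_wpM2l ?(ltW l0)// expr0 exprn_ege1.
  apply: (@le_trans _ _ (mu (Q k) `^ (al - 1) * (a%:E * mu (Q 0%N)))); last first.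
    rewrite lee_wpmul2l ?poweR_ge0//; apply: integral_ge_cst => //.
    - exact: measurable_cube.
    - by rewrite lee_fin ltW.
    - by move=> y yQ; rewrite gee0_abs// /f indicE mem_set// mule1.
  rewrite !muQ expr0 mulr1 poweR_EFin -!EFinM lee_fin.
  have q1al : (q * (al - 1) = -1)%R by have := target_exp_conj hg; rewrite !mulrBr; lra.
  rewrite powRM ?invr_ge0 ?(ltW tau0) ?exprn_ge0 ?powR_ge0//.
  have -> : (((2 `^ q) ^+ k) `^ (al - 1) = (2 ^+ k)^-1 :> R)%R.
    by rewrite powR_expr ?powR_ge0// -powRrM q1al powR_inv1// exprVn.
  have -> : (tau^-1 `^ (al - 1) = tau `^ (- al) * tau)%R.
    rewrite -[in LHS]powR_inv1 ?(ltW tau0)// -powRrM mulN1r opprB addrC.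
    by rewrite powRD ?(gt_eqF tau0) ?implybT// powRr1 ?(ltW tau0).
  apply: (@le_trans _ _ (u / 2 ^+ k * (2 * C))%R).
    by rewrite ler_wpM2l ?(ltW (uk0 k)) ?(ltW lamC).
  rewrite /u le_eqVlt; apply/orP; left; apply/eqP; field.
  by rewrite expf_neq0// !gt_eqF.
(* At a point [x] only the cubes containing [x] count, and the value of [beta] there dominates each
   of their [b k]; the halving lemma sums them with no loss. *)
have sumb N : \sum_(k < N) (2^-1)%:E * b k * mu (Q k) <= 1.
  apply: le_trans Ilam; apply: (@sum_mul_measure_le _ _ _ mu Q (fun k => (2^-1)%:E * b k)
    beta) => [k|k|x].
  - exact: measurable_cube.
  - by rewrite mule_ge0// lee_fin.
  rewrite (eq_bigr (fun k : 'I_N => (2^-1)%:E * b k * (x \in Q k)%:R%:E)); last first.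
    by move=> k _; rewrite indicE.
  apply: (sum_halves_indic_le (s := fun k => x \in Q k)) => // k /set_mem.
  exact: Qbeta.
pose S k : set R := `[(u / 2 ^+ k.+1)%R, (u / 2 ^+ k)%R[%classic.
have Psiu : B_integral n gamma B u <=
    \sum_(k <oo) b k * ((u / 2 ^+ k.+1) `^ (- (q + 1)))%:E * lebesgue_measure (S k).
  apply: (@integral_le_series _ _ _ lebesgue_measure _ S
    (fun k => b k * ((u / 2 ^+ k.+1) `^ (- (q + 1)))%:E)) => //.
  - by move=> k; exact: measurable_itv.
  - by move=> k; rewrite mule_ge0 ?lee_fin ?powR_ge0.
  - move=> s /=; rewrite in_itv/= => /andP[s0 _].
    by rewrite mule_ge0 ?inve_ge0 ?lee_fin ?powR_ge0// (young_ge0 yB)// ltW.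
  move=> s /=; rewrite in_itv/= => su; have /andP[s0 _] := su.
  have [k sk] := dyadic_bracket su.
  apply: le_trans (nneseries_ge_term k _); last first.
    by move=> i; rewrite !mule_ge0 ?lee_fin ?powR_ge0.
  have Sk : s \in S k by rewrite inE /S /= in_itv.
  rewrite indicE Sk mule1; case/andP: sk => sk1 sk2.
  apply: lee_pmul; rewrite ?inve_ge0 ?lee_fin ?powR_ge0 ?(young_ge0 yB) ?(ltW s0)//.
    by apply: young_le => //; exact: ltW.
  rewrite inver gt_eqF ?powR_gt0// lee_fin powRN lef_pV2 ?posrE ?powR_gt0//.
  by rewrite ge0_ler_powR ?nnegrE ?(ltW s0) ?(ltW (uk0 _))// addr_ge0// ltW.
have muS k : lebesgue_measure (S k) = (u / 2 ^+ k.+1)%:E.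
  rewrite /S lebesgue_measure_itv/= lte_fin ltr_pM2l// ltf_pV2 ?posrE ?exprn_gt0//.
  rewrite ltr_eXn2l ?ltr1n// ltnSn -EFinB; congr (_%:E).
  by rewrite exprS; field; rewrite expf_neq0.
rewrite -(F_fun_le_divE n gamma B (_ * _)%:E u0).
apply: (le_trans Psiu); apply: nneseries_le => [k|N].
  by rewrite muS !mule_ge0 ?lee_fin ?powR_ge0// ltW.
(* The shell [S k] contributes [b k (u / 2^(k+1))^(-q)]. Since [mu (Q k) = 2^(kq) / tau], this is
   [2^(q+1) tau / u^q] times the summand [b k mu (Q k) / 2] already controlled. *)
rewrite (eq_bigr (fun k : 'I_N => (2 `^ (q + 1) * tau / u `^ q)%:E *
    ((2^-1)%:E * b k * mu (Q k)))); last first.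
  move=> k _; rewrite muS muQ -!muleA -EFinM [in RHS]muleCA [in RHS]muleC -!muleA -!EFinM.
  congr (_ * _%:E); have ukn : (u / 2 ^+ k.+1 != 0)%R by rewrite gt_eqF.
  rewrite opprD [((u / _) `^ _)%R]powRD ?ukn ?implybT// powR_inv1 ?(ltW (uk0 _))//.
  rewrite powRN powRM ?invr_ge0 ?(ltW u0) ?exprn_ge0//.
  have -> : ((2 ^+ k.+1)^-1 `^ q = ((2 `^ q) ^+ k.+1)^-1 :> R)%R.
    by rewrite -exprVn powR_expr ?invr_ge0// -powR_inv1// powRAC powR_inv1 ?powR_ge0// exprVn.
  rewrite powRD ?(gt_eqF (ltr0n _ 2)) ?implybT// powRr1// !exprS; field.
  by rewrite !expf_neq0 ?(gt_eqF tau0) ?(gt_eqF u0) ?gt_eqF ?powR_gt0.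
rewrite -ge0_sume_distrr; last first.
  by move=> k _; rewrite !mule_ge0 ?lee_fin ?measure_ge0.
rewrite inver gt_eqF ?powR_gt0// -EFinM -[leRHS]mule1 lee_wpmul2l//.
  by rewrite lee_fin divr_ge0 ?mulr_ge0 ?powR_ge0 ?ltW.
exact: sumb.
Qed.

End NormInequality.

(** * A Vitali covering argument for cubes *)

Lemma seq_argmax (R : realDomainType) (I : eqType) (l : I -> R) (s : seq I) :
  s != [::] -> exists2 i, i \in s & forall j, j \in s -> (l j <= l i)%R.
Proof.
elim: s => // i s IH _; have [->|/IH[k ks kmax]] := eqVneq s [::].
  by exists i; rewrite ?mem_head// => j; rewrite inE => /eqP ->.
have [lik|lki] := leP (l i) (l k).
  by exists k; rewrite ?inE ?ks ?orbT// => j; rewrite inE => /predU1P[->//|/kmax].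
exists i; rewrite ?mem_head// => j; rewrite inE => /predU1P[->//|/kmax/le_trans].
by apply; exact: ltW.
Qed.

Section Covering.
Local Open Scope ereal_scope.
Context {R : realType} (n : nat).
Local Notation mu := (lebesgue R n).

Lemma cube_sub_triple (a b : 'I_n -> R) (l m : R) x :
  cube a l x -> cube b m x -> (m <= l)%R ->
  cube b m `<=` cube (fun i => a i - l)%R (3 * l)%R.
Proof.
by move=> xa xb ml y yb i; move: (xa i) (xb i) (yb i) => /andP[? ?] /andP[? ?] /andP[? ?]; lra.
Qed.

Context (h : euclidean R n -> \bar R) (mh : measurable_fun setT h).
Hypothesis h0 : forall x, 0 <= h x.
Variable eta : R.
Hypothesis eta0 : (0 <= eta)%R.

(* Induction on the number of cubes: a cube of maximal side absorbs, after
   tripling, every cube that meets it. *)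
Lemma vitali_cubes (I : choiceType) (a : I -> 'I_n -> R) (l : I -> R) (s : seq I) :
  (forall i, i \in s -> (0 < l i)%R) ->
  (forall i, i \in s ->
    eta%:E * mu (cube (a i) (l i)) <= \int[mu]_(x in cube (a i) (l i)) h x) ->
  eta%:E * mu (\big[setU/set0]_(i <- s) cube (a i) (l i)) <=
  (3 ^+ n)%:E * \int[mu]_(x in \big[setU/set0]_(i <- s) cube (a i) (l i)) h x.
Proof.
pose Q i := cube (a i) (l i).
have mQ (r : seq I) : measurable (\big[setU/set0]_(i <- r) Q i).
  by apply: bigsetU_measurable => i _; exact: measurable_cube.
have [k] := ubnP (size s); elim: k s => // k IH s; rewrite ltnS => sk l0 hs.
have [->|s0] := eqVneq s [::].
  by rewrite big_nil measure0 mule0 mule_ge0 ?lee_fin ?integral_ge0.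
have [i si imax] := seq_argmax l s0; pose r := [seq j <- s | `[< Q i `&` Q j = set0 >]].
have sub_r : {subset r <= s} by move=> j; rewrite mem_filter => /andP[].
(* [Q i] contains its own corner, so it meets itself and is not kept in [r]. *)
have ri : (size r < size s)%N.
  rewrite size_filter -(count_predC [pred j | `[< Q i `&` Q j = set0 >]] s) -ltn_subLR ?subnn//.
  rewrite -has_count; apply/hasP; exists i => //=; apply/negP => /asboolP Qi0.
  suff : set0 (([tuple a i j | j < n]) : euclidean R n) by [].
  rewrite -Qi0 setIid => j; rewrite /eucl_coord tnth_mktuple lexx/= lerDl ltW//.
  exact: l0.
set Ur := \big[setU/set0]_(j <- r) Q j.
have IHr : eta%:E * mu Ur <= (3 ^+ n)%:E * \int[mu]_(x in Ur) h x.
  apply: IH => [|j /sub_r|j /sub_r]; [exact: leq_trans ri sk|exact: l0|exact: hs].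
pose T := cube (fun j => a i j - l i)%R (3 * l i)%R.
have mT : measurable T by exact: measurable_cube.
have cover : \big[setU/set0]_(j <- s) Q j `<=` T `|` Ur.
  rewrite -bigcup_seq => x [j /= js Qjx].
  case: (pselect (Q i `&` Q j = set0)) => [Qij|/eqP/set0P[y [Qiy Qjy]]].
    right; rewrite /Ur -bigcup_seq; exists j => //=.
    by rewrite mem_filter js andbT; apply/asboolP.
  by left; apply: (cube_sub_triple Qiy Qjy) => //; exact: imax.
have disj : [disjoint Q i & Ur].
  apply/disj_setPS => x [Qix]; rewrite /Ur -bigcup_seq => -[j /=].
  rewrite mem_filter => /andP[/asboolP Qij _] Qjx.
  by have : (Q i `&` Q j) x by []; rewrite Qij.
apply: (@le_trans _ _ (eta%:E * (mu T + mu Ur))).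
  rewrite lee_wpmul2l ?lee_fin//.
  apply: (@le_trans _ _ (mu (T `|` Ur))); last exact: (measureU2 mu mT (mQ r)).
  by apply: le_measure => //; rewrite inE//; apply: measurableU => //; exact: mQ.
have -> : mu T = (3 ^+ n)%:E * mu (Q i).
  by rewrite !lebesgue_cube ?mulr_ge0 ?(ltW (l0 _ si))// exprMn EFinM.
rewrite ge0_muleDr ?mule_ge0 ?lee_fin ?exprn_ge0// muleCA.
apply: (@le_trans _ _ ((3 ^+ n)%:E * \int[mu]_(x in Q i `|` Ur) h x)).
  rewrite (ge0_integral_setU mu (measurable_cube _ _) (mQ r))//; last exact: measurable_funTS.
  rewrite ge0_muleDr ?integral_ge0//; apply: leeD => //.
  by rewrite lee_wpmul2l ?lee_fin ?exprn_ge0// hs.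
rewrite lee_wpmul2l ?lee_fin ?exprn_ge0//; apply: le_integral_set_ge0 => //.
rewrite -bigcup_seq; move=> x [Qix|]; first by exists i.
by rewrite /Ur -bigcup_seq => -[j /= /sub_r js Qjx]; exists j.
Qed.

(** The finite bound is uniform in the number of cubes, so exhausting [P] by the indices of code
    below [N] and continuity of the measure from below suffice. *)
Lemma vitali_cubes_countable (I : countType) (P : set I) (a : I -> 'I_n -> R)
    (l : I -> R) :
  (forall i, P i -> (0 < l i)%R) ->
  (forall i, P i ->
    eta%:E * mu (cube (a i) (l i)) <= \int[mu]_(x in cube (a i) (l i)) h x) ->
  eta%:E * mu (\bigcup_(i in P) cube (a i) (l i)) <=
  (3 ^+ n)%:E * \int[mu]_x h x.
Proof.
move=> l0 hP; pose Q i := cube (a i) (l i).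
pose s N := [seq i <- pmap unpickle (iota 0 N) | `[< P i >] && (pickle i < N)%N].
have memP N i : (i \in s N) = `[< P i >] && (pickle i < N)%N.
  rewrite mem_filter andb_idr// => /andP[_ iN].
  by rewrite mem_pmap; apply/mapP; exists (pickle i); rewrite ?pickleK// mem_iota.
pose U N := \big[setU/set0]_(i <- s N) Q i.
have mU N : measurable (U N).
  by apply: bigsetU_measurable => i _; exact: measurable_cube.
have UE : \bigcup_(i in P) Q i = \bigcup_N U N.
  apply/seteqP; split => x.
    move=> [i Pi Qix]; exists (pickle i).+1 => //; rewrite /U -bigcup_seq.
    by exists i => //=; rewrite memP ltnSn andbT; apply/asboolP.
  move=> [N _]; rewrite /U -bigcup_seq => -[i /=]; rewrite memP => /andP[/asboolP Pi _] Qix.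
  by exists i.
rewrite -/Q UE.
have ndU : nondecreasing_seq U.
  move=> N N' NN'; apply/subsetPset; rewrite /U -!bigcup_seq => x [i /=].
  by rewrite memP => /andP[Pi iN] Qix; exists i => //=; rewrite memP Pi (leq_trans iN).
have UN N : eta%:E * mu (U N) <= (3 ^+ n)%:E * \int[mu]_x h x.
  apply: (@le_trans _ _ ((3 ^+ n)%:E * \int[mu]_(x in U N) h x)).
    by apply: vitali_cubes => i; rewrite memP => /andP[/asboolP Pi _]; [exact: l0|exact: hP].
  by rewrite lee_wpmul2l ?lee_fin ?exprn_ge0//; exact: le_integral_set_ge0.
have cvgU : eta%:E * mu (U N) @[N --> \oo] --> eta%:E * mu (\bigcup_N U N).
  by apply: cvgeZl => //; apply: nondecreasing_cvg_mu => //; exact: bigcupT_measurable.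
rewrite -(cvg_lim _ cvgU)//; apply: lime_le; last by apply: nearW => N; exact: UN.
by apply/cvg_ex; exists (eta%:E * mu (\bigcup_N U N)).
Qed.

End Covering.

(** * Level sets of the fractional maximal function *)

Section LevelSets.
Local Open Scope ereal_scope.
Context {R : realType} (n : nat) (gamma : R).
Hypothesis hg : (0 < gamma < n%:R)%R.

Local Notation al := (gamma / n%:R)%R.
Local Notation F := (F_fun n gamma).
Local Notation mu := (lebesgue R n).
Local Notation M := (frac_maximal gamma).

Let al0 : (0 < al)%R. Proof. exact: order_ratio_gt0. Qed.

Context (f : euclidean R n -> \bar R) (mf : measurable_fun setT f).

Definition upper_part (a : R) (x : euclidean R n) : \bar R :=
  `|f x| * (\1_[set y | (a%:E < `|f y|)%E] x)%:E.

Let mabs : measurable_fun setT (fun x => `|f x|).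
Proof. exact: measurableT_comp. Qed.

Lemma upper_part_ge0 a x : 0 <= upper_part a x.
Proof. by rewrite mule_ge0// lee_fin. Qed.

Lemma measurable_upper_part a : measurable_fun setT (upper_part a).
Proof.
apply: emeasurable_funM; first exact: mabs.
apply/measurable_EFinP/measurable_indic.
rewrite -[X in measurable X]setTI.
exact: (emeasurable_fun_o_infty measurableT mabs).
Qed.

Lemma abs_le_upper_part a x : (0 <= a)%R -> `|f x| <= a%:E + upper_part a x.
Proof.
move=> a0; rewrite /upper_part indicE; have [fa|] := boolP (a%:E < `|f x|).
  by rewrite mem_set// mule1 leeDr// lee_fin.
by rewrite -leNgt => fa; rewrite memNset ?mule0 ?adde0//=; apply/negP; rewrite -leNgt.
Qed.

(** The part of [|f|] not exceeding [a] accounts for at most [a l^n], half of the assumed mass. *)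
Lemma upper_part_integral_gt (c : 'I_n -> R) (l a : R) : (0 < l)%R -> (0 <= a)%R ->
  (2 * a * l ^+ n)%:E < \int[mu]_(x in cube c l) `|f x| ->
  (a * l ^+ n)%:E < \int[mu]_(x in cube c l) upper_part a x.
Proof.
move=> l0 a0; rewrite !ltNge; apply: contra => H.
have mQ := measurable_cube c l.
apply: (@le_trans _ _ (\int[mu]_(x in cube c l) (a%:E + upper_part a x))).
  by apply: le_integral_ge0 => // x _; exact: abs_le_upper_part.
rewrite ge0_integralD//; last 2 first.
- by move=> x _; exact: upper_part_ge0.
- by apply: measurable_funTS; exact: measurable_upper_part.
rewrite integral_cst// lebesgue_cube ?(ltW l0)// -EFinM.
apply: le_trans (leeD2l _ H) _.
by rewrite -EFinD lee_fin le_eqVlt; apply/orP; left; apply/eqP; ring.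
Qed.

Context (A : R -> \bar R) (yA : young_function A).
Local Notation IA := (\int[mu]_x young_ext A `|f x|).

(** By convexity [A r / r] is nondecreasing, so [A] lies above the line of slope [v / a] beyond [a].
    The real [v] replaces [A a], which may be infinite. *)
Lemma young_ext_upper_part (a v : R) x : (0 < a)%R -> (0 <= v)%R -> v%:E <= A a ->
  (v / a)%:E * upper_part a x <= young_ext A `|f x|.
Proof.
move=> a0 v0 va; rewrite /upper_part indicE.
have [fa|nfa] := boolP (a%:E < `|f x|); last first.
  rewrite memNset; last exact/negP.
  by rewrite mulr0n mule0 mule0; exact: young_ext_ge0.
rewrite mem_set// mule1; case: `|f x| fa => [r| |]//=; rewrite ?leey// lte_fin => ar.
have r0 := lt_trans a0 ar.
have := young_contract yA (ltW r0) (_ : 0 <= a / r <= 1)%R.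
rewrite divfK ?gt_eqF// divr_ge0 ?(ltW a0) ?(ltW r0)//= ler_pdivrMr// mul1r (ltW ar).
move=> /(_ isT)/(le_trans va); rewrite -lee_pdivrMl ?divr_gt0//; apply: le_trans.
by rewrite -!EFinM lee_fin le_eqVlt; apply/orP; left; apply/eqP; field; rewrite !gt_eqF.
Qed.

(* Replaces Jensen's inequality, at the cost of a factor 2. *)
Lemma young_average_le (c : 'I_n -> R) (l a : R) : (0 < l)%R -> (0 < a)%R ->
  (2 * a * l ^+ n)%:E < \int[mu]_(x in cube c l) `|f x| ->
  A a * (l ^+ n)%:E <= IA.
Proof.
move=> l0 a0 H; have {H}Ha := upper_part_integral_gt l0 (ltW a0) H.
have ln0 : (0 < l ^+ n)%R by exact: exprn_gt0.
have key v : (0 <= v)%R -> v%:E <= A a -> (v * l ^+ n)%:E <= IA.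
  move=> v0 va; apply: (@le_trans _ _ ((v / a)%:E *
      \int[mu]_(x in cube c l) upper_part a x)).
    have -> : (v * l ^+ n = v / a * (a * l ^+ n))%R by field; rewrite gt_eqF.
    by rewrite EFinM lee_wpmul2l ?lee_fin ?divr_ge0 ?(ltW a0)// ltW.
  rewrite -ge0_integralZl; last 4 first.
  - exact: measurable_cube.
  - by apply: measurable_funTS; exact: measurable_upper_part.
  - by move=> x _; exact: upper_part_ge0.
  - by rewrite lee_fin divr_ge0// ltW.
  apply: le_trans (@le_integral_set_ge0 _ _ _ mu (cube c l) setT _ _ _) => //.
    apply: le_integral_ge0 => x _; last exact: young_ext_upper_part.
    by rewrite mule_ge0 ?upper_part_ge0// lee_fin divr_ge0// ltW.
  by move=> x _; exact: young_ext_ge0.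
case E: (A a) (young_ge0 yA (ltW a0)) => [v| |]// v0.
  by rewrite -EFinM key// ?E// -lee_fin.
(* When [A a] is infinite, every real is an admissible [v], which forces the modular to be
   infinite. *)
rewrite gt0_mulye ?lte_fin// leye_eq; apply/eqP/eqyP => z z0.
have := key (z / l ^+ n)%R; rewrite divfK ?gt_eqF// E leey divr_ge0 ?(ltW z0) ?(ltW ln0)//.
by apply.
Qed.

(** Rational cubes form a countable family: their unions are measurable and the countable covering
    lemma applies to them. *)
Definition rational_corner (i : {ffun 'I_n -> rat} * rat) (j : 'I_n) : R := ratr (i.1 j).
Definition rational_side (i : {ffun 'I_n -> rat} * rat) : R := ratr i.2.
Local Notation rcube i := (cube (rational_corner i) (rational_side i)).

Definition heavy_cubes (t : R) : set ({ffun 'I_n -> rat} * rat) :=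
  [set i | (0 < rational_side i)%R /\
    t%:E < mu (rcube i) `^ (al - 1)%R * \int[mu]_(y in rcube i) `|f y|].

Definition heavy_set (t : R) : set (euclidean R n) :=
  \bigcup_(i in heavy_cubes t) rcube i.

Lemma measurable_heavy_set t : measurable (heavy_set t).
Proof.
rewrite /heavy_set bigcup_mkcond; apply: countable_bigcupT_measurable => // i.
by case: ifP => // _; exact: measurable_cube.
Qed.

(** The inequality [t < M f x] is strict, so a cube witnessing it can be enlarged slightly to a
    rational one and remain a witness. [heavy_set t] is thus a measurable set containing the level
    set. *)
Lemma frac_maximal_heavy (t : R) x : (0 < t)%R -> t%:E < M f x -> heavy_set t x.
Proof.
move=> t0 /ereal_sup_gt[z [Q [[a [l [l0 ->]]] xQ] <-{z}]]; rewrite -/(cube a l).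
have [_ gn] := andP hg; have d0 : (0 < n%:R - gamma)%R by rewrite subr_gt0.
have n0 : (0 < n%:R :> R)%R by rewrite ltr0n (dim_gt0 hg).
have muE b s : (0 < s)%R -> mu (cube b s) `^ (al - 1)%R = ((s `^ (n%:R - gamma))^-1)%:E.
  move=> s0; rewrite lebesgue_cube ?(ltW s0)// poweR_EFin -powRN.
  rewrite -powR_mulrn ?(ltW s0)// -powRrM; congr (_ `^ _)%:E.
  by field; rewrite gt_eqF.
rewrite muE// => tJ; set J := \int[mu]_(y in _) _ in tJ.
have [z /andP[tz zJ]] : exists z : R, (t < z)%R && (z%:E < ((l `^ (n%:R - gamma))^-1)%:E * J).
  case: (_ * J) tJ => [r| |]//; rewrite ?lte_fin => tr.
    by exists ((t + r) / 2)%R; rewrite lte_fin; apply/andP; split; lra.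
  by exists (t + 1)%R; rewrite ltry ltrDl ltr01.
(* The factor in front of the integral is the side to the power [-(n - gamma)], so enlarging the
   side by at most [rho] divides it by at most [z / t]. *)
pose rho := ((z / t) `^ (n%:R - gamma)^-1)%R.
have z0 := lt_trans t0 tz.
have rho1 : (1 < rho)%R.
  have := @gt0_ltr_powR R (n%:R - gamma)^-1%R _ 1%R (z / t)%R.
  by rewrite powR1 invr_gt0 !nnegrE ler01 divr_ge0 ?(ltW z0) ?(ltW t0)// ltr_pdivlMr// mul1r; exact.
have llrho : (l < rho * l)%R by rewrite ltr_pMl.
have [l' ll'] := rat_in_itvoo llrho; move: ll'; rewrite in_itv/= => /andP[ll' l'rho].
have l'0 := lt_trans l0 ll'.
have /choice[a' Ha'] : forall j, exists r : rat,
    (a j - (ratr l' - l) < ratr r < a j)%R.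
  move=> j; have [|r] := @rat_in_itvoo R (a j - (ratr l' - l))%R (a j).
    by rewrite gtrBl subr_gt0.
  by rewrite in_itv/= => ar; exists r.
pose i : {ffun 'I_n -> rat} * rat := ([ffun j => a' j], l').
have sub : cube a l `<=` rcube i.
  move=> y yQ j; have /andP[y1 y2] := yQ j; have /andP[a1 a2] := Ha' j.
  by rewrite /rational_corner /rational_side /= ffunE; apply/andP; split; lra.
exists i; last exact: sub.
split=> //; rewrite muE//.
have le1 : (rational_side i `^ (n%:R - gamma) <= z / t * l `^ (n%:R - gamma))%R.
  have -> : (z / t * l `^ (n%:R - gamma) = (rho * l) `^ (n%:R - gamma))%R.
    rewrite powRM ?(ltW l0) ?powR_ge0// /rho -powRrM mulVf ?gt_eqF//.
    by rewrite powRr1// divr_ge0 ?(ltW z0) ?(ltW t0).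
  apply: ge0_ler_powR; rewrite ?nnegrE; try exact: ltW.
  exact/ltW/(lt_trans l0).
have rs0 : (0 < rational_side i)%R := l'0.
have lpos : (0 < l `^ (n%:R - gamma))%R by exact: powR_gt0.
have zt0 : (0 < z / t)%R by exact: divr_gt0.
apply: (@lt_le_trans _ _ ((z / t * l `^ (n%:R - gamma))^-1%:E * J)).
  rewrite invfM EFinM -muleA -lte_pdivrMl ?invr_gt0// invrK -EFinM.
  by have -> : (z / t * t = z)%R by field; rewrite gt_eqF.
apply: lee_pmul; rewrite ?lee_fin ?invr_ge0 ?powR_ge0 ?integral_ge0//.
- by rewrite mulr_ge0// ltW.
- by rewrite lef_pV2// posrE ?powR_gt0// mulr_gt0.
- by apply: le_integral_set_ge0.
Qed.

Context (B : R -> \bar R) (yB : young_function B).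
Variables (C Ir p : R).
Hypotheses (C0 : (0 < C)%R) (p0 : (0 < p)%R) (Ir0 : (0 < Ir)%R).
Hypotheses (hcore : core_ineq n gamma A B C) (hIA : IA = Ir%:E).

Local Notation level := (2 * C * p * Ir `^ al)%R.

Lemma heavy_cube_estimate (c : 'I_n -> R) (l : R) : (0 < l)%R ->
  level%:E < mu (cube c l) `^ (al - 1)%R * \int[mu]_(y in cube c l) `|f y| ->
  exists2 phi : R, F B p = phi%:E &
    (C * p * phi `^ al)%:E * mu (cube c l) <=
    \int[mu]_(x in cube c l) upper_part (C * p * phi `^ al) x.
Proof.
move=> l0; rewrite lebesgue_cube ?(ltW l0)// poweR_EFin; set m := (l ^+ n)%R.
have m0 : (0 < m)%R by exact: exprn_gt0.
(* This [a] makes the hypothesis say that the average of [|f|] exceeds [2 a], whence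
   [A a <= Ir / m]; core with [tau = Ir / m] then has argument exactly [p]. *)
pose a := (C * p * (Ir / m) `^ al)%R.
have a0 : (0 < a)%R by rewrite !mulr_gt0 ?powR_gt0 ?divr_gt0.
have aE : (m `^ (al - 1) * (2 * a * m) = level)%R.
  have mV : (m^-1 `^ al = (m `^ al)^-1)%R.
    by rewrite -[(m^-1)%R]powR_inv1 ?(ltW m0)// powRAC powR_inv1// powR_ge0.
  rewrite /a powRM ?invr_ge0 ?(ltW Ir0) ?(ltW m0)// mV powRD ?(gt_eqF m0) ?implybT//.
  by rewrite powR_inv1 ?(ltW m0)//; field; rewrite !gt_eqF// powR_gt0.
rewrite -aE EFinM lte_pmul2l ?lte_fin ?powR_gt0// => aJ.
have Aa : A a <= (Ir / m)%:E.
  by have := young_average_le l0 a0 aJ; rewrite hIA EFinM -/m lee_pdivlMr.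
have Fp : F B p <= (Ir / m)%:E.
  have := hcore a0 (divr_gt0 Ir0 m0) Aa; rewrite powRN /a mulfK ?gt_eqF ?powR_gt0 ?divr_gt0//.
  by rewrite [(C * p)%R]mulrC mulfK// gt_eqF.
have Ffin : F B p \is a fin_num.
  by rewrite ge0_fin_numE ?F_fun_ge0// (le_lt_trans Fp)// ltry.
exists (fine (F B p)); first by rewrite fineK.
set phi := fine _; have phim : (phi <= Ir / m)%R by rewrite -lee_fin fineK.
have phi0 : (0 <= phi)%R by rewrite fine_ge0// F_fun_ge0.
have ea : (C * p * phi `^ al <= a)%R.
  rewrite ler_wpM2l ?mulr_ge0 ?(ltW C0) ?(ltW p0)// ge0_ler_powR ?nnegrE ?(ltW al0)//.
  by rewrite divr_ge0 ?(ltW Ir0) ?(ltW m0).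
rewrite -EFinM ltW//; apply: upper_part_integral_gt => //.
  by rewrite !mulr_ge0 ?powR_ge0 ?(ltW C0) ?(ltW p0).
by apply: le_lt_trans aJ; rewrite lee_fin ler_wpM2r ?(ltW m0)// ler_wpM2l.
Qed.

Lemma heavy_set_estimate (phi : R) : F B p = phi%:E ->
  (C * p * phi `^ al)%:E * mu (heavy_set level) <=
  (3 ^+ n)%:E * \int[mu]_x upper_part (C * p * phi `^ al) x.
Proof.
move=> Fphi; have phi0 : (0 <= phi)%R by rewrite -lee_fin -Fphi F_fun_ge0.
apply: (@vitali_cubes_countable R n _ (measurable_upper_part _) (upper_part_ge0 _) _ _ _
  (heavy_cubes level) rational_corner rational_side _ _).
- by rewrite !mulr_ge0 ?powR_ge0 ?(ltW C0) ?(ltW p0).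
- by move=> i [].
- by move=> i [i0 /(heavy_cube_estimate i0)[psi]]; rewrite Fphi => -[->].
Qed.

(** A single heavy cube would force [F B p] to be finite. *)
Lemma heavy_set_empty : F B p = +oo -> heavy_set level = set0.
Proof.
move=> Fy; apply/seteqP; split => // x [i [i0 /(heavy_cube_estimate i0)[psi]]].
by rewrite Fy.
Qed.

End LevelSets.

(** * Concavity of powers, enumeration of the integers, telescoping *)

(** The tangent-line inequality, obtained from the weighted bound [(y/x)^r <= r (y/x) + 1 - r], i.e.
    Young's inequality with exponents [1/r] and [1/(1-r)]. *)
Lemma powR_concave (R : realType) (x y r : R) : (0 <= y <= x)%R -> (0 < x)%R ->
  (0 < r < 1)%R -> (r * (x - y) * x `^ (r - 1) <= x `^ r - y `^ r)%R.
Proof.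
move=> /andP[y0 yx] x0 /andP[r0 r1].
have t0 : (0 <= y / x)%R by rewrite divr_ge0// ltW.
have := @conjugate_powR R ((y / x) `^ r) 1 r^-1 (1 - r)^-1 (powR_ge0 _ _) ler01.
rewrite !invr_gt0 subr_gt0 r0 r1 !invrK => /(_ isT isT).
rewrite addrCA subrr addr0 => /(_ erefl); rewrite mulr1 powR1 -powRrM divff ?gt_eqF//.
rewrite powRr1// mul1r powRM ?invr_ge0 ?(ltW x0)// => H.
have xV : (x^-1 `^ r = (x `^ r)^-1)%R.
  by rewrite -[(x^-1)%R]powR_inv1 ?(ltW x0)// powRAC powR_inv1// powR_ge0.
have xr0 : (0 < x `^ r)%R by exact: powR_gt0.
move: H; rewrite xV ler_pdivrMr// powRD ?(gt_eqF x0) ?implybT// powR_inv1 ?(ltW x0)// => H.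
rewrite -subr_ge0; apply: le_trans (_ : 0 <= (y / x * r + (1 - r)) * x `^ r - y `^ r)%R _.
  by rewrite subr_ge0.
by rewrite le_eqVlt; apply/orP; left; apply/eqP; field; rewrite gt_eqF.
Qed.

Section IntEnumeration.
Local Open Scope ereal_scope.

Definition int_enum (k : nat) : int :=
  if odd k then Negz k./2 else Posz k./2.

Lemma int_enum_surj (j : int) : exists k, int_enum k = j.
Proof.
case: j => m; [exists m.*2|exists m.*2.+1]; rewrite /int_enum /= odd_double/=.
  by rewrite doubleK.
by rewrite uphalf_double.
Qed.

(** The first [2N] values of the enumeration fill the window from [-N] to [N - 1]; this turns a
    series over the naturals into sums in increasing order of the dyadic exponent. *)
Lemma sum_int_enum (R : realType) (G : int -> \bar R) N :
  \sum_(k < N.*2) G (int_enum k) = \sum_(i < N.*2) G (i%:Z - N%:Z)%R.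
Proof.
elim: N => [|N IH]; first by rewrite !big_ord0.
rewrite doubleS [in LHS]big_ord_recr [in LHS]big_ord_recr /= IH.
rewrite [in RHS]big_ord_recl [in RHS]big_ord_recr /=.
rewrite /int_enum /= odd_double /= doubleK uphalf_double [in RHS]addeC -!addeA.
congr (_ + (_ + _)).
- apply: eq_bigr => i _; congr G; rewrite /bump/=; lia.
- by congr G; rewrite /bump /=; lia.
- by congr G; lia.
Qed.

End IntEnumeration.

(** The active indices are closed under predecessors, so in any window they form an initial segment.
    Over it the sum collapses to at most [c] times the last active [Y]. *)
Lemma telescoping_sum_le (R : realType) (D Y : int -> R) (act : int -> bool)
    (c T : R) (j0 : int) N : (0 <= c)%R -> (0 <= T)%R ->
  (forall j, 0 <= Y j)%R -> (forall j, act j -> act (j - 1)%R) ->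
  (forall j, act j -> D j <= c * (Y j - Y (j - 1)))%R ->
  (forall j, act j -> c * Y j <= T)%R -> (forall j, ~~ act j -> D j = 0%R) ->
  (\sum_(i < N) D (j0 + i%:Z) <= T)%R.
Proof.
move=> c0 T0 Y0 actP DY YT D0.
have act_sum k : act (j0 + k%:Z)%R -> (\sum_(i < k.+1) D (j0 + i%:Z) <= c * Y (j0 + k%:Z))%R.
  elim: k => [|k IH] ka.
    rewrite big_ord_recr big_ord0 /= add0r; apply: le_trans (DY _ ka) _.
    by rewrite ler_wpM2l// gerBl.
  have kE : (j0 + k.+1%:Z - 1 = j0 + k%:Z)%R by rewrite -addn1 PoszD addrA addrK.
  have := actP _ ka; rewrite kE => /IH IHk.
  rewrite big_ord_recr /=; apply: le_trans (lerD IHk (DY _ ka)) _.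
  by rewrite kE -mulrDr addrCA subrr addr0.
elim: N => [|N IH]; first by rewrite big_ord0.
have [Na|Na] := boolP (act (j0 + N%:Z)%R).
  by apply: le_trans (act_sum _ Na) _; exact: YT.
by rewrite big_ord_recr /= D0// addr0.
Qed.

(** * Dyadic weights and their telescoping sum *)

Section DyadicSums.
Local Open Scope ereal_scope.
Context {R : realType} (n : nat) (gamma : R).
Hypothesis hg : (0 < gamma < n%:R)%R.

Local Notation al := (gamma / n%:R)%R.
Local Notation q := (@target_exp R n gamma).
Local Notation F := (F_fun n gamma).
Local Notation Psi := (B_integral n gamma).

Let al0 : (0 < al)%R. Proof. exact: order_ratio_gt0. Qed.
Let al1 : (al < 1)%R. Proof. exact: order_ratio_lt1. Qed.
Let q1 : (1 < q)%R. Proof. exact: target_exp_gt1. Qed.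
Let q0 : (0 < q)%R. Proof. exact: target_exp_gt0. Qed.

Context (A B : R -> \bar R) (yA : young_function A) (yB : young_function B).
Variable C : R.
Hypotheses (C0 : (0 < C)%R) (hcore : core_ineq n gamma A B C).

(** The factor [3^n] pays for the covering, [q = 1 / (1 - al)] for the concavity of the power
    [1 - al], and 2 for the factor 1/2 in [B_integral_double]. *)
Definition modular_factor : R := (2 * q * 3 ^+ n)%R.
Local Notation kap := modular_factor.

Lemma modular_factor_ge1 : (1 <= kap)%R.
Proof.
rewrite /modular_factor -[leLHS]mulr1 ler_pM ?exprn_ege1 ?ler1n//.
by rewrite -[leLHS]mulr1 ler_pM ?ler1n// ltW.
Qed.

Let kap0 : (0 < kap)%R. Proof. exact: lt_le_trans ltr01 modular_factor_ge1. Qed.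

Definition dyadic (j : int) : R := (2 ^ j)%R.

Lemma dyadic_gt0 j : (0 < dyadic j)%R. Proof. exact: exprz_gt0. Qed.

Lemma dyadic_pred j : (dyadic (j - 1) = dyadic j / 2)%R.
Proof. by rewrite /dyadic expfzDr// exprN1. Qed.

Lemma dyadic_int_bracket (w : R) : (0 < w)%R ->
  exists j, (dyadic j < w <= 2 * dyadic j)%R.
Proof.
move=> w0; pose m := Num.bound w^-1.
have wm : (0 < w^-1 < 2 ^+ m)%R.
  rewrite invr_gt0 w0/=; apply: lt_le_trans (archi_boundP _) _; first by rewrite invr_ge0 ltW.
  by rewrite -natrX ler_nat ltnW// ltn_expl.
have [k /andP[k1 k2]] := dyadic_bracket wm.
exists (k%:Z - m%:Z)%R; rewrite /dyadic expfzDr// -exprnN -exprnP.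
move: k1 k2; rewrite ler_pdivrMr ?exprn_gt0// ltr_pdivlMr ?exprn_gt0// => k1 k2.
apply/andP; split.
  by rewrite ltr_pdivrMr ?exprn_gt0//; rewrite ltr_pdivrMl// in k2.
by rewrite mulrA -exprS ler_pdivlMr ?exprn_gt0//; rewrite ler_pdivlMl// in k1.
Qed.

Local Notation p := dyadic.
(* For F(p j) = 0 or F(p j) = +oo the threshold is 0, and so is the weight,
   as fine +oo = 0 and x / 0 = 0. *)
Definition threshold j : R := (C * p j * fine (F B (p j)) `^ al)%R.
Definition level_weight j : \bar R := (kap^-1)%:E * B (p j / 2)%R.
Definition upper_weight j : R := (3 ^+ n * fine (level_weight j) / threshold j)%R.

Lemma level_weight_ge0 j : 0 <= level_weight j.
Proof.
rewrite mule_ge0 ?lee_fin ?invr_ge0 ?(ltW kap0)//.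
by rewrite (young_ge0 yB)// divr_ge0// ltW// dyadic_gt0.
Qed.

Lemma threshold_ge0 j : (0 <= threshold j)%R.
Proof. by rewrite !mulr_ge0 ?powR_ge0 ?(ltW C0)// ltW// dyadic_gt0. Qed.

Lemma upper_weight_ge0 j : (0 <= upper_weight j)%R.
Proof.
apply: divr_ge0; last exact: threshold_ge0.
by rewrite mulr_ge0 ?exprn_ge0// fine_ge0// level_weight_ge0.
Qed.

Lemma level_weight_le j : level_weight j <= 2%:E * F B (p j).
Proof.
have pj2 : (0 < p j / 2)%R by rewrite divr_gt0// dyadic_gt0.
have := le_F_fun_double hg yB pj2; have -> : (2 * (p j / 2) = p j)%R by field.
move=> H; apply: le_trans H.
rewrite -[leRHS]mul1e lee_wpmul2r ?(young_ge0 yB) ?(ltW pj2)//.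
by rewrite lee_fin invf_le1// modular_factor_ge1.
Qed.

(** For finite positive [w] one term is enough: if [p j < w <= 2 p j], convexity gives
    [B (w / (4 kap)) <= B (w / 4) / kap], and [w / 4 <= p j / 2]. For [w = +oo] every level is
    counted and [B] is unbounded. *)
Lemma level_weight_series_ge (w : \bar R) : 0 <= w ->
  young_ext B (w * ((4 * kap)^-1)%:E) <=
  \sum_(k <oo) level_weight (int_enum k) * (((p (int_enum k))%:E < w)%E%:R)%:E.
Proof.
pose u (w : \bar R) k := level_weight (int_enum k) * (((p (int_enum k))%:E < w)%E%:R)%:E.
have u0 w' k : 0 <= u w' k by rewrite mule_ge0 ?level_weight_ge0// lee_fin.
move=> w0; rewrite -[leRHS]/(\sum_(k <oo) u w k); case: w w0 => [w| |]// w0.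
  move: w0; rewrite lee_fin le_eqVlt => /predU1P[<-|w0].
    by rewrite mul0e /= young0// nneseries_ge0// => k _ _; exact: u0.
  have [j /andP[jw wj]] := dyadic_int_bracket w0; have [k kj] := int_enum_surj j.
  apply: le_trans (nneseries_ge_term k (u0 _)); rewrite /u kj lte_fin jw mule1 /=.
  have -> : (w / (4 * kap) = kap^-1 * (w / 4))%R by field; rewrite gt_eqF.
  have w40 : (0 <= w / 4)%R by rewrite divr_ge0// ltW.
  apply: le_trans (young_contract yB w40 _) _.
    by rewrite invr_ge0 (ltW kap0)/= invf_le1// modular_factor_ge1.
  rewrite lee_wpmul2l ?lee_fin ?invr_ge0 ?(ltW kap0)//.
  by apply: young_le => //; lra.
have k40 : (0 < (4 * kap)^-1)%R by rewrite invr_gt0 mulr_gt0.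
rewrite gt0_mulye//= leye_eq; apply/eqP/eqyP => M M0.
have [t t0 Mt] := young_unbounded yB (kap * M)%R.
(* The shift by 2 ensures [t <= 2 p j = p (j + 2) / 2], the point where the weight evaluates [B]. *)
have [j /andP[_ tj]] := dyadic_int_bracket t0; have [k kj] := int_enum_surj (j + 2)%R.
apply: le_trans (nneseries_ge_term k (u0 _)); rewrite /u kj ltry mule1.
rewrite /level_weight lee_pdivlMl// -EFinM; apply: le_trans (ltW Mt) _.
apply: young_le => //; first exact: ltW.
by rewrite /dyadic expfzDr// -/(dyadic j); have := dyadic_gt0 j; rewrite -exprnP; lra.
Qed.

Lemma level_weight_measure_le (f : euclidean R n -> \bar R) (Ir : R) j :
  measurable_fun setT f -> (0 < Ir)%R ->
  \int[lebesgue R n]_x young_ext A `|f x| = Ir%:E ->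
  level_weight j * lebesgue R n (heavy_set gamma f (2 * C * p j * Ir `^ al)) <=
  (upper_weight j)%:E * \int[lebesgue R n]_x upper_part f (threshold j) x.
Proof.
move=> mf Ir0 hI; have pj0 := dyadic_gt0 j.
have I0 t : 0 <= \int[lebesgue R n]_x upper_part f t x.
  by apply: integral_ge0 => x _; exact: upper_part_ge0.
have [Fy|Fy] := eqVneq (F B (p j)) +oo.
  rewrite (heavy_set_empty hg mf yA yB C0 pj0 Ir0 hcore hI Fy) measure0 mule0.
  by rewrite mule_ge0// lee_fin upper_weight_ge0.
have Ffin : F B (p j) \is a fin_num by rewrite ge0_fin_numE ?F_fun_ge0// ltey.
have wfin : level_weight j \is a fin_num.
  rewrite ge0_fin_numE ?level_weight_ge0// (le_lt_trans (level_weight_le j))//.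
  by rewrite -(fineK Ffin) -EFinM ltry.
have := heavy_set_estimate hg mf yA yB C0 pj0 Ir0 hcore hI (esym (fineK Ffin)).
rewrite -/(threshold j) => H.
(* Dividing by the threshold requires it to be nonzero; if it vanishes, [F B (p j) = 0] and hence
   the level weight vanishes too. *)
have [eta0|eta0] := eqVneq (threshold j) 0%R.
  have F0 : F B (p j) = 0.
    apply/eqP; rewrite -fine_eq0//; apply/eqP/(@powR_eq0_eq0 _ _ al)/eqP.
    by move/eqP: eta0; rewrite /threshold !mulf_eq0 (gt_eqF C0) (gt_eqF pj0).
  have w0 : level_weight j = 0.
    by apply/eqP; rewrite eq_le level_weight_ge0 andbT -(mule0 2%:E) -F0 level_weight_le.
  by rewrite w0 mul0e mule_ge0// lee_fin upper_weight_ge0.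
have {}eta0 : (0 < threshold j)%R by rewrite lt_def eta0 threshold_ge0.
rewrite -(fineK wfin) /upper_weight.
have -> : (3 ^+ n * fine (level_weight j) / threshold j =
  fine (level_weight j) / threshold j * 3 ^+ n)%R by field; rewrite gt_eqF.
rewrite EFinM -muleA; apply: le_trans (lee_wpmul2l _ H).
  by rewrite muleA -EFinM divfK ?gt_eqF.
by rewrite lee_fin divr_ge0 ?(ltW eta0)// fine_ge0// level_weight_ge0.
Qed.

(** For a value [v] of [|f|], these are the levels that can contribute to the sum; [Y] below is the
    quantity in which the upper weights telescope. *)
Let active v j := (F B (p j) != +oo) && (threshold j < v)%R.
Let X j : R := fine (Psi B (p j)).
Let Y j : R := (X j `^ (1 - al))%R.

Lemma B_integral_fineE j : F B (p j) != +oo ->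
  Psi B (p j) = (X j)%:E /\ fine (F B (p j)) = (p j `^ q * X j)%R.
Proof.
move=> Fj; have pq0 : (0 < p j `^ q)%R by rewrite powR_gt0// dyadic_gt0.
have Psifin : Psi B (p j) \is a fin_num.
  rewrite ge0_fin_numE ?B_integral_ge0// ltey; apply: contra Fj => /eqP Py.
  by rewrite /F_fun Py gt0_muley.
split; first by rewrite /X fineK.
by rewrite /F_fun -{1}(fineK Psifin) -EFinM.
Qed.

Lemma active_pred v j : active v j -> active v (j - 1).
Proof.
move=> /andP[Fj jv]; have pj0 := dyadic_gt0 j; have pj1 := dyadic_gt0 (j - 1).
have pp : (p (j - 1) <= p j)%R by rewrite dyadic_pred; lra.
have FF : F B (p (j - 1)) <= F B (p j) by apply: (F_fun_le hg yB) => //; exact: ltW.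
have Fj1 : F B (p (j - 1)) != +oo.
  by rewrite -ltey (le_lt_trans FF)// ltey.
rewrite /active Fj1 /=; apply: le_lt_trans jv; rewrite /threshold.
have F0 i : 0 <= F B (p i) by exact: F_fun_ge0.
apply: ler_pM.
- by apply: mulr_ge0; exact: ltW.
- exact: powR_ge0.
- by apply: ler_wpM2l => //; exact: ltW.
- apply: ge0_ler_powR; rewrite ?nnegrE ?fine_ge0//; first exact: ltW.
  by apply: fine_le => //; rewrite ge0_fin_numE// ltey.
Qed.

Let upper_weight_arith (P Xa b x y z : R) : (0 < P)%R -> (0 < Xa)%R ->
  (y + 2^-1 / P * b <= x)%R -> ((1 - al) * (x - y) / Xa <= z)%R ->
  (3 ^+ n * (kap^-1 * b) / (C * P * Xa) <= C^-1 * z)%R.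
Proof.
move=> P0 Xa0 dbl cv.
have qal : (1 - al = q^-1)%R.
  by rewrite -(mulKf (lt0r_neq0 q0) (1 - al)%R) target_exp_conj// mulr1.
have -> : (3 ^+ n * (kap^-1 * b) / (C * P * Xa) =
    C^-1 * (q^-1 * (2^-1 / P * b) / Xa))%R.
  rewrite /modular_factor; field.
  by rewrite !gt_eqF// exprn_gt0.
apply: ler_wpM2l; first by rewrite invr_ge0 ltW.
apply: le_trans cv; apply: ler_wpM2r; first by rewrite invr_ge0 ltW.
by rewrite qal; apply: ler_wpM2l; [rewrite invr_ge0 ltW|lra].
Qed.

(** Since [1 + al q = q], the threshold equals [C (p j)^q (X j)^al]. Doubling bounds [B (p j / 2)]
    by the increment of [X], and concavity turns this increment divided by [(X j)^al] into the
    increment of [Y]. *)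
Lemma upper_weight_telescope v j : active v j ->
  (upper_weight j <= C^-1 * (Y j - Y (j - 1)))%R.
Proof.
move=> ja; have /andP[Fj _] := ja; have /andP[Fj1 _] := active_pred ja.
have pj0 := dyadic_gt0 j.
have [Xj Fphi] := B_integral_fineE Fj; have [Xj1 _] := B_integral_fineE Fj1.
have x0 : (0 < p j / 2)%R by rewrite divr_gt0.
have X0 : (0 <= X (j - 1))%R by rewrite fine_ge0// B_integral_ge0.
have XX : (X (j - 1) <= X j)%R.
  by rewrite -lee_fin -Xj -Xj1 (B_integral_le _ _ yB)// dyadic_pred; lra.
have YY : (0 <= C^-1 * (Y j - Y (j - 1)))%R.
  rewrite mulr_ge0 ?invr_ge0 ?(ltW C0)// subr_ge0 ge0_ler_powR ?nnegrE//.
    by rewrite subr_ge0 ltW.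
  exact: le_trans XX.
have [eta0|eta0] := eqVneq (threshold j) 0%R.
  by rewrite /upper_weight eta0 invr0 mulr0.
have Xpos : (0 < X j)%R.
  rewrite lt_def (le_trans X0 XX) andbT; apply: contra eta0 => /eqP Xj0.
  by rewrite /threshold Fphi Xj0 mulr0 powR0 ?(gt_eqF al0)// mulr0.
have Bfin : B (p j / 2)%R \is a fin_num.
  rewrite ge0_fin_numE ?(young_ge0 yB) ?(ltW x0)//.
  apply: le_lt_trans (le_F_fun_double hg yB x0) _.
  have -> : (2 * (p j / 2) = p j)%R by field.
  by rewrite lte_mul_pinfty// ltey.
set b := fine (B (p j / 2)%R); have Bb : B (p j / 2)%R = b%:E by rewrite fineK.
have dbl : (X (j - 1) + 2^-1 * p j `^ (- q) * b <= X j)%R.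
  have := B_integral_double hg yB x0.
  have -> : (2 * (p j / 2) = p j)%R by field.
  by rewrite -dyadic_pred Xj Xj1 dyadic_pred Bb -EFinM -EFinD lee_fin.
have cv : ((1 - al) * (X j - X (j - 1)) * X j `^ (- al) <= Y j - Y (j - 1))%R.
  have := @powR_concave R (X j) (X (j - 1)) (1 - al)%R.
  have -> : (1 - al - 1 = - al)%R by ring.
  apply; [by rewrite X0 XX|exact: Xpos|].
  by rewrite subr_gt0 al1 gtrBl al0.
rewrite /upper_weight /level_weight Bb -EFinM /= /threshold Fphi.
rewrite powRM ?powR_ge0 ?(ltW Xpos)// -powRrM.
have pqE : (p j * p j `^ (q * al) = p j `^ q)%R.
  rewrite -{1}(powRr1 (ltW pj0)) -powRD ?(gt_eqF pj0) ?implybT//.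
  by rewrite [(q * al)%R]mulrC target_exp_step.
have pq0 : (0 < p j `^ q)%R by exact: powR_gt0.
have Xa0 : (0 < X j `^ al)%R by exact: powR_gt0.
have -> : (C * p j * (p j `^ (q * al) * X j `^ al) = C * p j `^ q * X j `^ al)%R.
  by rewrite -pqE; ring.
rewrite powRN in dbl; rewrite powRN in cv.
exact: (@upper_weight_arith _ _ _ _ _ _ pq0 Xa0 dbl cv).
Qed.

(** Let [u = v tau^(-al) / C], so [F u <= tau] by core; the aim is [Y j <= tau^(1-al) / u]. If
    [p j <= u], monotonicity gives [X j <= u^(-q) tau]. If [p j > u], activity gives
    [F (p j) <= tau], and [Y j = F (p j)^(1-al) / p j]. *)
Lemma active_bound v tau j : (0 < v)%R -> (0 < tau)%R -> A v <= tau%:E ->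
  active v j -> (v * Y j <= C * tau)%R.
Proof.
move=> v0 tau0 Av ja; have /andP[Fj jv] := ja; have pj0 := dyadic_gt0 j.
have [Xj Fphi] := B_integral_fineE Fj.
have Xj0 : (0 <= X j)%R by rewrite fine_ge0// B_integral_ge0.
pose u := (v * tau `^ (- al) / C)%R.
have u0 : (0 < u)%R by rewrite divr_gt0 ?mulr_gt0 ?powR_gt0.
have Fu : F B u <= tau%:E by exact: hcore.
suff H : (Y j <= u^-1 * tau `^ (1 - al))%R.
  apply: le_trans (ler_wpM2l (ltW v0) H) _.
  rewrite /u powRN powRD ?(gt_eqF tau0) ?implybT// powRN powRr1 ?(ltW tau0)//.
  rewrite le_eqVlt; apply/orP; left; apply/eqP; field.
  by rewrite !gt_eqF// powR_gt0.
have al10 : (0 <= 1 - al)%R by rewrite subr_ge0 ltW.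
have uq0 : (0 < u `^ q)%R by exact: powR_gt0.
have qpow z : (0 < z)%R -> ((z `^ q)^-1 `^ (1 - al) = z^-1)%R.
  move=> z0; rewrite -powRN -powRrM mulNr target_exp_conj//.
  by rewrite powR_inv1// ltW.
have [pu|up] := leP (p j) u.
  have Xle : (X j <= (u `^ q)^-1 * tau)%R.
    rewrite ler_pdivlMl// -lee_fin EFinM -Xj; apply: le_trans Fu.
    by rewrite lee_wpmul2l ?lee_fin ?(ltW uq0)// (B_integral_le _ _ yB).
  apply: le_trans (ge0_ler_powR _ _ _ Xle) _ => //; rewrite ?nnegrE//.
    by rewrite mulr_ge0 ?invr_ge0 ?(ltW uq0) ?(ltW tau0).
  by rewrite powRM ?invr_ge0 ?(ltW uq0) ?(ltW tau0)// qpow.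
set phi := fine (F B (p j)) in Fphi; have phi0 : (0 <= phi)%R.
  by rewrite fine_ge0// F_fun_ge0.
have pq0 : (0 < p j `^ q)%R by exact: powR_gt0.
have phitau : (phi `^ al <= tau `^ al)%R.
  have : (u * phi `^ al <= p j * phi `^ al)%R by rewrite ler_wpM2r ?powR_ge0// ltW.
  move: jv; rewrite /threshold -/phi -mulrA -ltr_pdivlMl// => /ltW pv /le_trans/(_ pv).
  by rewrite -ler_pdivlMl// /u powRN => /le_trans; apply; rewrite le_eqVlt;
    apply/orP; left; apply/eqP; field; rewrite !gt_eqF// powR_gt0.
have {}phitau : (phi <= tau)%R.
  rewrite leNgt; apply/negP => tp; move: phitau; rewrite leNgt => /negP; apply.
  by rewrite gt0_ltr_powR// nnegrE// ltW.
have -> : Y j = ((p j)^-1 * phi `^ (1 - al))%R.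
  rewrite Fphi powRM ?(ltW pq0)// -powRrM target_exp_conj// powRr1 ?(ltW pj0)//.
  by rewrite mulKf ?gt_eqF.
apply: ler_pM; rewrite ?powR_ge0 ?invr_ge0 ?(ltW pj0)//.
  by rewrite lef_pV2 ?posrE// ltW.
by rewrite ge0_ler_powR ?nnegrE// ltW.
Qed.

Lemma upper_weight_sum_le (v tau : R) (j0 : int) N :
  (0 < v)%R -> (0 < tau)%R -> A v <= tau%:E ->
  (\sum_(i < N) upper_weight (j0 + i%:Z) * (threshold (j0 + i%:Z) < v)%R%:R * v <= tau)%R.
Proof.
move=> v0 tau0 Av; rewrite -mulr_suml -ler_pdivlMr//.
apply: (@telescoping_sum_le _ (fun j => upper_weight j * (threshold j < v)%R%:R)%R
  Y (active v) C^-1).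
- by rewrite invr_ge0 ltW.
- by rewrite divr_ge0// ltW.
- by move=> j; exact: powR_ge0.
- exact: active_pred.
- move=> j ja; apply: le_trans (upper_weight_telescope ja).
  by case: (_ < _)%R; rewrite ?mulr1 ?mulr0 ?upper_weight_ge0.
- move=> j ja; rewrite ler_pdivlMr// mulrC mulrCA ler_pdivrMl//.
  exact: active_bound ja.
- move=> j; rewrite negb_and negbK => /orP[/eqP Fy|/negbTE ->]; last by rewrite mulr0.
  by rewrite /upper_weight /threshold Fy /= powR0 ?(gt_eqF al0)// mulr0 invr0 mulr0 mul0r.
Qed.

End DyadicSums.

(** * From the core inequality to the modular inequality *)

Section ModularInequality.
Local Open Scope ereal_scope.
Context {R : realType} (n : nat) (gamma : R).
Hypothesis hg : (0 < gamma < n%:R)%R.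

Local Notation al := (gamma / n%:R)%R.
Local Notation mu := (lebesgue R n).
Local Notation M := (frac_maximal gamma).
Local Notation kap := (modular_factor n gamma).

Let kap0 : (0 < kap)%R.
Proof. exact: lt_le_trans ltr01 (modular_factor_ge1 hg). Qed.

Context (A B : R -> \bar R) (yA : young_function A) (yB : young_function B).
Variable C : R.
Hypotheses (C0 : (0 < C)%R) (hcore : core_ineq n gamma A B C).

(** Core makes [A] positive on the positive reals, so a cube with nonzero integral of [|f|] would
    give a positive modular. This settles the case 0/0. *)
Lemma frac_maximal_eq0 (f : euclidean R n -> \bar R) x :
  measurable_fun setT f -> \int[mu]_y young_ext A `|f y| = 0 -> M f x = 0.
Proof.
move=> mf I0; apply/eqP; rewrite eq_le frac_maximal_ge0// andbT.
apply: ge_ereal_sup => _ [Q [[a [l [l0 ->]]] xQ] <-]; rewrite -/(cube a l).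
suff -> : \int[mu]_(y in cube a l) `|f y| = 0 by rewrite mule0.
apply/eqP; rewrite eq_le integral_ge0// andbT leNgt; apply/negP => J0.
have ln0 : (0 < l ^+ n)%R by exact: exprn_gt0.
have [z /andP[z0 zJ]] : exists z : R, (0 < z)%R && (z%:E < \int[mu]_(y in cube a l) `|f y|).
  case: (\int[mu]_(y in cube a l) _) J0 => [r| |]//; rewrite ?lte_fin => r0.
    by exists (r / 2)%R; rewrite lte_fin; apply/andP; split; lra.
  by exists 1%R; rewrite ltry ltr01.
pose v := (z / (2 * l ^+ n))%R.
have v0 : (0 < v)%R by rewrite divr_gt0// mulr_gt0.
have := @young_average_le _ _ f mf A yA a l v l0 v0.
have -> : (2 * v * l ^+ n = z)%R by rewrite /v; field; rewrite gt_eqF.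
move=> /(_ zJ); rewrite I0 leNgt => /negP; apply.
by rewrite mule_gt0 ?lte_fin//; exact: (core_ineq_pos hg yA yB C0 hcore).
Qed.

Lemma upper_part_series_le (f : euclidean R n -> \bar R) x :
  \sum_(k <oo) (upper_weight n gamma B C (int_enum k))%:E *
    upper_part f (threshold n gamma B C (int_enum k)) x <= young_ext A `|f x|.
Proof.
set G := fun j => (upper_weight n gamma B C j)%:E * upper_part f (threshold n gamma B C j) x.
have G0 j : 0 <= G j by rewrite mule_ge0 ?upper_part_ge0// lee_fin upper_weight_ge0.
apply: (@nneseries_le _ (G \o int_enum)) => [k|N]; first exact: G0.
apply: (@le_trans _ _ (\sum_(k < N.*2) G (int_enum k))).
  by apply: (@lee_sum_nneg_ord _ (G \o int_enum) xpredT) => //=; rewrite -addnn leq_addr.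
(* Symmetric windows are reordered by increasing exponent, the order in which the weights
   telescope. *)
rewrite sum_int_enum.
case fx : `|f x| (abse_ge0 (f x)) => [v| |]// => [|_]; last by rewrite leey.
rewrite lee_fin le_eqVlt => /predU1P[v0|v0].
  by rewrite /= big1 ?(young_ge0 yA) ?v0// => i _; rewrite /G /upper_part fx -v0 mul0e mule0.
have Av0 : 0 < A v by exact: (core_ineq_pos hg yA yB C0 hcore).
case Av : (A v) Av0 => [tau| |]//=; rewrite ?Av ?leey// lte_fin => tau0.
rewrite (eq_bigr (fun i : 'I_(N.*2) =>
   (upper_weight n gamma B C (- N%:Z + i%:Z) *
    (threshold n gamma B C (- N%:Z + i%:Z) < v)%R%:R * v)%:E)).
  rewrite sumEFin lee_fin.
  by apply: (upper_weight_sum_le hg yB C0 hcore) => //; rewrite Av.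
move=> i _; rewrite /G /upper_part fx [(i%:Z - N%:Z)%R]addrC indicE -!EFinM -mulrA;
  congr (_ * _)%:E.
rewrite [RHS]mulrC; congr (_ * _%:R)%R; congr nat_of_bool.
by apply/idP/idP => [/set_mem/=|H]; rewrite ?inE/= fx lte_fin.
Qed.

Lemma core_modular : modular_ineq n gamma A B (8 * kap * C).
Proof.
move=> f [mf _]; cbv zeta; set IA := \int[mu]_y young_ext A `|f y|.
have IA0 : 0 <= IA by apply: integral_ge0 => x _; exact: young_ext_ge0.
have [->|IAy] := eqVneq IA +oo; first by rewrite leey.
have [IAz|IAnz] := eqVneq IA 0.
  rewrite IAz (eq_integral (cst 0)) ?integral0// => x _.
  by rewrite frac_maximal_eq0// mul0e /= young0.
have [Ir Ir0 IAE] : exists2 Ir : R, (0 < Ir)%R & IA = Ir%:E.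
  move: IA0 IAy IAnz; case: IA => // r r0 _ rn; exists r => //.
  by rewrite lt_def -lee_fin r0 andbT.
rewrite IAE poweR_EFin -EFinM; set K := (8 * kap * C * Ir `^ al)%R.
have K0 : (0 < K)%R.
  by apply: mulr_gt0; [apply: mulr_gt0; [apply: mulr_gt0|]|exact: powR_gt0].
pose level j := (2 * C * dyadic j * Ir `^ al)%R : R.
have level0 j : (0 < level j)%R 
  by apply: mulr_gt0; [apply: mulr_gt0; [apply: mulr_gt0|exact: dyadic_gt0]|exact: powR_gt0].
pose S k := heavy_set gamma f (level (int_enum k)).
apply: (@le_trans _ _ (\sum_(k <oo) level_weight n gamma B (int_enum k) * mu (S k))).
  apply: integral_le_series => [k|k|x _|x _].
  - exact: measurable_heavy_set.
  - exact: level_weight_ge0.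
  - apply: young_ext_ge0 => //; rewrite mule_ge0 ?frac_maximal_ge0//.
    by rewrite inve_ge0 lee_fin ltW.
  have D0 : (0 < 2 * C * Ir `^ al)%R by rewrite !mulr_gt0 ?powR_gt0.
  (* The constant [8 kap C] splits as [2 C], the normalization of the heavy sets, times [4 kap], the
     loss in the dyadic decomposition of [B]. *)
  have -> : M f x / K%:E = M f x * ((2 * C * Ir `^ al)^-1)%:E * ((4 * kap)^-1)%:E.
    rewrite inver gt_eqF// -muleA -EFinM; congr (_ * _%:E).
    by rewrite /K; field; rewrite !gt_eqF// powR_gt0.
  apply: le_trans (level_weight_series_ge hg yB _) _.
    by rewrite mule_ge0 ?frac_maximal_ge0// lee_fin invr_ge0 ltW.
  apply: lee_nneseries => [k _ _|k _].
    by rewrite mule_ge0 ?level_weight_ge0// lee_fin.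
  rewrite lee_wpmul2l ?level_weight_ge0// lee_fin.
  rewrite indicE; case: (boolP ((dyadic (int_enum k))%:E < _)) => [H|_]; last by rewrite ler0n.
  rewrite mem_set//; apply: frac_maximal_heavy => //.
  move: H; rewrite lte_pdivlMr// -EFinM; congr (_%:E < _).
  by rewrite /level; ring.
apply: (@le_trans _ _ (\sum_(k <oo) (upper_weight n gamma B C (int_enum k))%:E *
   \int[mu]_x upper_part f (threshold n gamma B C (int_enum k)) x)).
  apply: lee_nneseries => [k _ _|k _].
    by rewrite mule_ge0 ?level_weight_ge0.
  exact: (level_weight_measure_le hg yA yB C0 hcore).
rewrite -IAE; under eq_eseriesr => k _.
  rewrite -ge0_integralZl; last 4 first.
  - exact: measurableT.
  - exact: measurable_upper_part.
  - by move=> x _; exact: upper_part_ge0.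
  - by rewrite lee_fin; exact: upper_weight_ge0.
  over.
have G0 k x : 0 <= (upper_weight n gamma B C (int_enum k))%:E *
    upper_part f (threshold n gamma B C (int_enum k)) x.
  by rewrite mule_ge0 ?upper_part_ge0// lee_fin upper_weight_ge0.
rewrite -integral_nneseries; last 3 first.
- exact: measurableT.
- move=> k; apply: emeasurable_funM; first exact: measurable_cst.
  exact: measurable_upper_part.
- by move=> k x _; exact: G0.
apply: le_integral_ge0 => x _; last exact: upper_part_series_le.
by apply: nneseries_ge0 => k _ _; exact: G0.
Qed.

End ModularInequality.

(** * Passage between the assertions with control of the constants *)

(** The constant is chosen before [A] and [B] are introduced, which expresses that it depends on
    [C], [n] and [gamma] alone. *)
Lemma assertion_core (R : realType) (n : nat) (gamma : R) (i : 'I_4) (C : R) :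
  (0 < gamma < n%:R)%R -> (0 < C)%R ->
  exists2 C' : R, (0 < C')%R & forall A B, young_function A -> young_function B ->
    assertion n gamma i A B C -> core_ineq n gamma A B C'.
Proof.
move=> hg C0; rewrite /assertion; case: i => [[|[|[|i]]] i4] /=.
- exists (2 `^ (target_exp n gamma + 1) * (2 * C))%R; first by rewrite !mulr_gt0 ?powR_gt0.
  by move=> A B yA yB H; apply: norm_core.
- exists (2 `^ (target_exp n gamma + 1) * (2 * C))%R; first by rewrite !mulr_gt0 ?powR_gt0.
  by move=> A B yA yB H; apply: norm_core => //; exact: modular_norm.
- exists (2 * C)%R; first by rewrite mulr_gt0.
  by move=> A B yA yB H; apply: domain_core.
- exists (3 * (6 * C))%R; first by rewrite !mulr_gt0.
  by move=> A B yA yB H; apply: range_core.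
Qed.

Lemma core_assertion (R : realType) (n : nat) (gamma : R) (j : 'I_4) (C : R) :
  (0 < gamma < n%:R)%R -> (0 < C)%R ->
  exists2 C' : R, (0 < C')%R & forall A B, young_function A -> young_function B ->
    core_ineq n gamma A B C -> assertion n gamma j A B C'.
Proof.
move=> hg C0; have K0 : (0 < 8 * modular_factor n gamma * C)%R.
  by rewrite mulr_gt0// mulr_gt0// (lt_le_trans ltr01)// modular_factor_ge1.
rewrite /assertion; case: j => [[|[|[|j]]] j4] /=.
- exists (8 * modular_factor n gamma * C)%R => // A B yA yB H.
  by apply: modular_norm => //; exact: core_modular.
- by exists (8 * modular_factor n gamma * C)%R => // A B yA yB H; apply: core_modular.
- exists (4 * C)%R; first by rewrite mulr_gt0.
  by move=> A B yA yB H; apply: core_domain.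
- exists (2 * C)%R; first by rewrite mulr_gt0.
  by move=> A B yA yB H; apply: core_range.
Qed.

Theorem theorem3p3 (R : realType) (n : nat) (gamma : R)
    (hgamma : 0 < gamma < n%:R) :
  (forall A B : R -> \bar R, young_function A -> young_function B ->
    [<-> exists2 C1 : R, 0 < C1 & norm_ineq n gamma A B C1;
         exists2 C2 : R, 0 < C2 & modular_ineq n gamma A B C2;
         exists2 C3 : R, 0 < C3 & domain_ineq n gamma A B C3;
         exists2 C4 : R, 0 < C4 & range_ineq n gamma A B C4]) /\
  (forall (i j : 'I_4) (C : R), 0 < C ->
    exists2 C' : R, 0 < C' &
      forall A B : R -> \bar R, young_function A -> young_function B ->
        assertion n gamma i A B C -> assertion n gamma j A B C').
Proof.
(* Any two assertions are linked through the core inequality; the equivalences follow from this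
   quantitative form. *)
have dep (i j : 'I_4) (C : R) : 0 < C -> exists2 C' : R, 0 < C' &
    forall A B : R -> \bar R, young_function A -> young_function B ->
      assertion n gamma i A B C -> assertion n gamma j A B C'.
  move=> /(assertion_core i hgamma)[K K0 iK].
  have [C' C'0 Kj] := core_assertion j hgamma K0.
  by exists C' => // A B yA yB /(iK _ _ yA yB)/(Kj _ _ yA yB).
split=> // A B yA yB.
have imp (i j : 'I_4) : (exists2 C, 0 < C & assertion n gamma i A B C) ->
    exists2 C, 0 < C & assertion n gamma j A B C.
  by move=> [C /(dep i j)[C' C'0 ij] iC]; exists C' => //; exact: ij.
tfae.
- exact: (imp (@Ordinal 4 0 isT) (@Ordinal 4 1 isT)).
- exact: (imp (@Ordinal 4 1 isT) (@Ordinal 4 2 isT)).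
- exact: (imp (@Ordinal 4 2 isT) (@Ordinal 4 3 isT)).
- exact: (imp (@Ordinal 4 3 isT) (@Ordinal 4 0 isT)).
Qed.
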